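(* Let $m,\ell\in\mathbb{R}$, let $M^3_{m,\ell}$ be the corresponding Bianchi-Cartan-Vranceanu space and let $r\ge2$ be an integer. Then there exists a proper CMC $r$-harmonic Hopf cylinder in $M^3_{m,\ell}$ if and only if one of the following holds: (i) $4m-\ell^2>0$ and $r\ge2$; (ii) $4m-\ell^2=0$, $\ell\ne0$ and $r\ge5$; (iii) $4m-\ell^2<0$, $4m-\frac{3\ell^2}{4}>0$ and $$r\ge\frac{4\left(\sqrt2\sqrt{\ell^4-4\ell^2m}+4m\right)}{16m-3\ell^2}.$$
   Context: For $m,\ell\in\mathbb{R}$ the Bianchi-Cartan-Vranceanu (BCV) space is $M^3_{m,\ell}=(\bar M\times\mathbb{R},g)$, where $\bar M=\{(x,y)\in\mathbb{R}^2: 1+m(x^2+y^2)>0\}$ and $$g=\frac{dx^2+dy^2}{[1+m(x^2+y^2)]^2}+\Big[dz+\frac{\ell}{2}\,\frac{y\,dx-x\,dy}{1+m(x^2+y^2)}\Big]^2 .$$ The map $\pi(x,y,z)=(x,y)$ is a Riemannian submersion of $M^3_{m,\ell}$ onto $M^2(4m)=\big(\bar M,h=\frac{dx^2+dy^2}{[1+m(x^2+y^2)]^2}\big)$, a surface of constant curvature $4m$. Given a smooth curve $\gamma:I\to M^2(4m)$ parametrized by arc length ($I$ an interval), the Hopf cylinder over $\gamma$ is the surface $\Sigma=\bigcup_{s\in I}\pi^{-1}(\gamma(s))$, parametrized by $(s,t)\mapsto(x(s),y(s),t)$, where $\gamma(s)=(x(s),y(s))$, and regarded as an immersed surface with the induced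 metric. CMC means that the mean curvature function is constant. (The quantity $4m-\frac{3\ell^2}{4}$ is the sectional curvature $\overline{R}_{1212}$ of the horizontal planes of $\pi$.) $r$-harmonicity: for an isometric immersion $\varphi:M\to N$ between Riemannian manifolds, let $\tau=\tau(\varphi)=\mathrm{trace}\,\nabla d\varphi$ be the tension field, $\nabla^\varphi$ the induced connection on $\varphi^{-1}TN$, and $\overline{\Delta}=-\sum_i\big(\nabla^\varphi_{e_i}\nabla^\varphi_{e_i}-\nabla^\varphi_{\nabla^M_{e_i}e_i}\big)$ the rough Laplacian on sections of $\varphi^{-1}TN$, with $\{e_i\}$ a local orthonormal frame tangent to $M$. The curvature convention is $R^N(X,Y)Z=\nabla_X\nabla_YZ-\nabla_Y\nabla_XZ-\nabla_{[X,Y]}Z$. The immersion (submanifold) is $r$-harmonic, $r\ge2$, if its $r$-tension field $\tau_r(\varphi)$ vanishes, where (sums over $i$ understood), for $r=2s$, $s\ge1$, $$\tau_{2s}=\overline{\Delta}^{2s-1}\tau-R^N\big(\overline{\Delta}^{2s-2}\tau,d\varphi(e_i)\big)d\varphi(e_i)-\sum_{p=1}^{s-1}\Big\{R^N\big(\nabla^\varphi_{e_i}\overline{\Delta}^{s+p-2}\tau,\overline{\Delta}^{s-p-1}\tau\big)d\varphi(e_i)-R^N\big(\overline{\Delta}^{s+p-2}\tau,\nabla^\varphi_{e_i}\overline{\Delta}^{s-p-1}\tau\big)d\varphi(e_i)\Big\},$$ and, for $r=2s+1$, $s\ge1$, $$\tau_{2s+1}=\overline{\Delta}^{2s}\tau-R^N\big(\overline{\Delta}^{2s-1}\tau,d\varphi(e_i)\big)d\varphi(e_i)-\sum_{p=1}^{s-1}\Big\{R^N\big(\nabla^\varphi_{e_i}\overline{\Delta}^{s+p-1}\tau,\overline{\Delta}^{s-p-1}\tau\big)d\varphi(e_i)-R^N\big(\overline{\Delta}^{s+p-1}\tau,\nabla^\varphi_{e_i}\overline{\Delta}^{s-p-1}\tau\big)d\varphi(e_i)\Big\}-R^N\big(\nabla^\varphi_{e_i}\overline{\Delta}^{s-1}\tau,\overline{\Delta}^{s-1}\tau\big)d\varphi(e_i).$$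 It is proper $r$-harmonic if it is $r$-harmonic and not minimal. *)

(* Defs.v *)
From HB Require Import structures.
From mathcomp Require Import all_boot all_order all_algebra.
From mathcomp Require Import all_classical all_reals all_analysis.
Import Order.TTheory GRing.Theory Num.Theory.
Import numFieldNormedType.Exports.

Set Implicit Arguments.
Unset Strict Implicit.
Unset Printing Implicit Defensive.

Local Open Scope classical_set_scope.
Local Open Scope ring_scope.

(** Riemannian geometry in a global chart.

    The manifolds involved (the BCV spaces and the surfaces I x R) are covered
    by one chart, so points and tangent vectors are row vectors.  A metric is
    its Gram matrix field in the coordinate frame, a map is its coordinate
    expression, and a section of the pull-back bundle phi^-1 TN is the vector
    of its components in the coordinate frame of N along phi.  Everything is a
    total function; values are meaningful only at points of the chart where
    the data are smooth and the metric is positive definite. *)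

Section Metric.
Context {R : realType} {n : nat}.
Implicit Types (g : 'rV[R]_n -> 'M[R]_n) (q u v w : 'rV[R]_n).

Definition coord_vec (i : 'I_n) : 'rV[R]_n := delta_mx 0 i.

Definition inner (G : 'M[R]_n) u v : R := (u *m G *m v^T) 0 0.

(* Gamma^k_ij *)
Definition christoffel g (k i j : 'I_n) q : R :=
  2^-1 * \sum_(l < n) invmx (g q) k l *
    ('D_(coord_vec i) (fun q' => g q' j l) q
     + 'D_(coord_vec j) (fun q' => g q' i l) q
     - 'D_(coord_vec l) (fun q' => g q' i j) q).

(* The l-th component of R(d_i, d_j) d_k, with the sign convention
   R(X,Y)Z = nabla_X nabla_Y Z - nabla_Y nabla_X Z - nabla_[X,Y] Z. *)
Definition riemann g (l i j k : 'I_n) q : R :=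
  'D_(coord_vec i) (christoffel g l j k) q
  - 'D_(coord_vec j) (christoffel g l i k) q
  + \sum_(a < n) (christoffel g l i a q * christoffel g a j k q
                  - christoffel g l j a q * christoffel g a i k q).

(* R(u, v) w at the point q *)
Definition curvature g q u v w : 'rV[R]_n :=
  \row_l \sum_(i < n) \sum_(j < n) \sum_(k < n)
    riemann g l i j k q * u 0 i * v 0 j * w 0 k.

End Metric.

(* [phi] maps a chart of dimension [d] into a chart of dimension [n] equipped
   with the metric [g]; the source carries the induced metric. *)
Section Immersion.
Context {R : realType} {d n : nat}.
Variables (g : 'rV[R]_n -> 'M[R]_n) (phi : 'rV[R]_d -> 'rV[R]_n).
Implicit Types (V W eta : 'rV[R]_d -> 'rV[R]_n) (p : 'rV[R]_d).

Definition dmap (a : 'I_d) p : 'rV[R]_n := 'D_(coord_vec a) phi p.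

Definition induced_metric p : 'M[R]_d :=
  \matrix_(a, b) inner (g (phi p)) (dmap a p) (dmap b p).

(* nabla^phi_{d_a} V *)
Definition nabla (a : 'I_d) V p : 'rV[R]_n :=
  'D_(coord_vec a) V p
  + \row_k \sum_(i < n) \sum_(j < n)
      christoffel g k i j (phi p) * dmap a p 0 i * V p 0 j.

(* The metric trace sum_i B(e_i, e_i) over an orthonormal frame (e_i), for a
   bilinear B given by its values B a b = B(d_a, d_b) on the coordinate
   frame. *)
Definition trace p (B : 'I_d -> 'I_d -> 'rV[R]_n) : 'rV[R]_n :=
  \sum_(a < d) \sum_(b < d) invmx (induced_metric p) a b *: B a b.

(* (nabla d phi)(d_a, d_b) *)
Definition second_form (a b : 'I_d) p : 'rV[R]_n :=
  nabla a (dmap b) p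
  - \sum_(c < d) christoffel induced_metric c a b p *: dmap c p.

Definition tension p : 'rV[R]_n := trace p (fun a b => second_form a b p).

Definition rough_laplacian V p : 'rV[R]_n :=
  - trace p (fun a b => nabla a (nabla b V) p
      - \sum_(c < d) christoffel induced_metric c a b p *: nabla c V p).

Definition lap_tension (k : nat) : 'rV[R]_d -> 'rV[R]_n :=
  iter k rough_laplacian tension.

(* sum_i R(V, d phi(e_i)) d phi(e_i) *)
Definition ricci_term V p : 'rV[R]_n :=
  trace p (fun a b => curvature g (phi p) (V p) (dmap a p) (dmap b p)).

(* sum_i R(nabla_{e_i} V, W) d phi(e_i) *)
Definition curv_nabla_l V W p : 'rV[R]_n :=
  trace p (fun a b => curvature g (phi p) (nabla a V p) (W p) (dmap b p)).

(* sum_i R(V, nabla_{e_i} W) d phi(e_i) *)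
Definition curv_nabla_r V W p : 'rV[R]_n :=
  trace p (fun a b => curvature g (phi p) (V p) (nabla a W p) (dmap b p)).

(* tau_{2s}, for s >= 1 *)
Definition tension_even (s : nat) p : 'rV[R]_n :=
  lap_tension (2 * s - 1) p
  - ricci_term (lap_tension (2 * s - 2)) p
  - \sum_(1 <= k < s)
      (curv_nabla_l (lap_tension (s + k - 2)) (lap_tension (s - k - 1)) p
       - curv_nabla_r (lap_tension (s + k - 2)) (lap_tension (s - k - 1)) p).

(* tau_{2s+1}, for s >= 1 *)
Definition tension_odd (s : nat) p : 'rV[R]_n :=
  lap_tension (2 * s) p
  - ricci_term (lap_tension (2 * s - 1)) p
  - \sum_(1 <= k < s)
      (curv_nabla_l (lap_tension (s + k - 1)) (lap_tension (s - k - 1)) p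
       - curv_nabla_r (lap_tension (s + k - 1)) (lap_tension (s - k - 1)) p)
  - curv_nabla_l (lap_tension (s - 1)) (lap_tension (s - 1)) p.

(* tau_r, for r >= 2 *)
Definition r_tension (r : nat) : 'rV[R]_d -> 'rV[R]_n :=
  if odd r then tension_odd r./2 else tension_even r./2.

Definition r_harmonic_on (D : set 'rV[R]_d) (r : nat) : Prop :=
  forall p, D p -> r_tension r p = 0.

Definition minimal_on (D : set 'rV[R]_d) : Prop :=
  forall p, D p -> tension p = 0.

Definition proper_r_harmonic_on (D : set 'rV[R]_d) (r : nat) : Prop :=
  r_harmonic_on D r /\ ~ minimal_on D.

(* For hypersurfaces (n = d + 1). *)
Definition unit_normal_on (D : set 'rV[R]_d) eta : Prop :=
  {within D, continuous eta} /\
  forall p, D p ->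
    inner (g (phi p)) (eta p) (eta p) = 1 /\
    forall a, inner (g (phi p)) (eta p) (dmap a p) = 0.

Definition mean_curvature eta p : R :=
  d%:R^-1 * inner (g (phi p)) (tension p) (eta p).

Definition CMC_on (D : set 'rV[R]_d) : Prop :=
  exists eta, unit_normal_on D eta /\
    exists H : R, forall p, D p -> mean_curvature eta p = H.

End Immersion.

Section BCV.
Context {R : realType}.
Variables (m l : R).

Definition bcv_factor (x y : R) : R := 1 + m * (x ^+ 2 + y ^+ 2).

Definition base_domain : set 'rV[R]_2 :=
  [set q | 0 < bcv_factor (q 0 0) (q 0 1)].

(* the metric h of M^2(4m) *)
Definition base_metric (q : 'rV[R]_2) : 'M[R]_2 :=
  (bcv_factor (q 0 0) (q 0 1) ^- 2)%:M.

Definition row3 (a b c : R) : 'rV[R]_3 := \row_(i < 3) [:: a; b; c]`_i.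

(* the components of the 1-form dz + (l/2) (y dx - x dy) / (1 + m (x^2+y^2)) *)
Definition bcv_form (q : 'rV[R]_3) : 'rV[R]_3 :=
  let x := q 0 0 in let y := q 0 1 in
  row3 (l / 2 * (y / bcv_factor x y)) (- (l / 2 * (x / bcv_factor x y))) 1.

(* the metric g of M^3_{m,l}, as a sum of squares of 1-forms *)
Definition bcv_metric (q : 'rV[R]_3) : 'M[R]_3 :=
  bcv_factor (q 0 0) (q 0 1) ^- 2 *: diag_mx (row3 1 1 0)
  + (bcv_form q)^T *m bcv_form q.

(* An interval with more than one point; it need not be open or bounded. *)
Definition nondegenerate_interval (I : set R) : Prop :=
  is_interval I /\ exists a b, [/\ I a, I b & a < b].

(* Smoothness on an arbitrary set: [gamma] has derivatives of all orders on a
   neighbourhood of every point of [I].  At an end point belonging to [I] this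
   asks for a smooth extension, whose derivatives there depend only on the
   restriction of [gamma] to [I]. *)
Definition smooth_curve_on (I : set R) (gamma : R -> 'rV[R]_2) : Prop :=
  forall s, I s -> \forall u \near s, forall k : nat,
    derivable (derive1n k gamma) u 1.

Definition arclength_curve_on (I : set R) (gamma : R -> 'rV[R]_2) : Prop :=
  smooth_curve_on I gamma /\
  forall s, I s -> base_domain (gamma s) /\
    inner (base_metric (gamma s)) (derive1 gamma s) (derive1 gamma s) = 1.

(* the parametrization (s, t) |-> (x(s), y(s), t) of the Hopf cylinder *)
Definition hopf_cylinder (gamma : R -> 'rV[R]_2) (p : 'rV[R]_2) : 'rV[R]_3 :=
  let s := p 0 0 in let t := p 0 1 in row3 (gamma s 0 0) (gamma s 0 1) t.

Definition hopf_domain (I : set R) : set 'rV[R]_2 := [set p | I (p 0 0)].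

End BCV.

(* Main.v *)
Require Import Defs.
From HB Require Import structures.
From mathcomp Require Import all_boot all_order all_algebra.
From mathcomp Require Import all_classical all_reals all_analysis.
From mathcomp Require Import ring lra zify.
Import Order.TTheory GRing.Theory Num.Theory.
Import numFieldNormedType.Exports.
Local Open Scope classical_set_scope.
Local Open Scope ring_scope.

Set Implicit Arguments.
Unset Strict Implicit.
Unset Printing Implicit Defensive.

(* Let T and N be the horizontal lifts of the unit tangent and unit normal of the
   curve, xi the unit vertical field and k the curvature of the curve.  The
   frame satisfies nabla_T T = k N, nabla_T N = - k T + (l/2) xi,
   nabla_T xi = nabla_xi T = - (l/2) N, nabla_xi N = (l/2) T, nabla_xi xi = 0, so
   that tau = k N.  If k is constant, N is an eigenvector of the rough Laplacian
   for the eigenvalue L = k^2 + l^2/2, and with K = 4 m - 3 l^2/4 every term of the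
   r-tension field is a multiple of N:
     tau_r = k L^(r-3) (L^2 - L (4 m - l^2/2) - (r-2) k^2 K) N.
   The bracket is the polynomial X^2 - (r K - 4 m) X + (l^2/2) (l^2 - 4 m) in
   X = k^2, and the three cases of the theorem say when it has a positive root.
   They all force m > 0, and then a circle around the origin of M^2(4m) can be
   given any curvature k > 0. *)

(** * Sums and case analysis over two or three indices *)

Lemma big_ord3 (V : nmodType) (f : 'I_3 -> V) :
  \sum_(i < 3) f i = f 0 + f 1 + f ord_max.
Proof.
by rewrite !big_ord_recr big_ord0 /= add0r; congr (f _ + f _ + f _); apply: val_inj.
Qed.

Lemma ord3_ind (P : 'I_3 -> Prop) : P 0 -> P 1 -> P ord_max -> forall i, P i.
Proof.
move=> P0 P1 P2 [[|[|[|//]]] hi].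
- by rewrite (_ : Ordinal hi = 0)//; apply: val_inj.
- by rewrite (_ : Ordinal hi = 1)//; apply: val_inj.
- by rewrite (_ : Ordinal hi = ord_max)//; apply: val_inj.
Qed.

Lemma big_ord2 (V : nmodType) (f : 'I_2 -> V) : \sum_(i < 2) f i = f 0 + f 1.
Proof. by rewrite !big_ord_recr big_ord0 /= add0r; congr (f _ + f _); apply: val_inj. Qed.

Lemma ord2_ind (P : 'I_2 -> Prop) : P 0 -> P 1 -> forall i, P i.
Proof.
move=> P0 P1 [[|[|//]] hi].
- by rewrite (_ : Ordinal hi = 0)//; apply: val_inj.
- by rewrite (_ : Ordinal hi = 1)//; apply: val_inj.
Qed.

(** * Polynomial expressions and their derivatives *)

(* Polynomials in the values of finitely many functions.  All the fields below are
   of this form (1 / (1 + m (x^2 + y^2)) being one of the functions), which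
   reduces iterated directional derivatives to a computation by [dderiv]. *)
Inductive dpoly (R : Type) :=
  | DVar of nat | DCst of R | DAdd of dpoly R & dpoly R
  | DMul of dpoly R & dpoly R.
Arguments DVar {R}.

Declare Scope dpoly_scope.
Delimit Scope dpoly_scope with DP.
Bind Scope dpoly_scope with dpoly.
Local Notation "e1 + e2" := (DAdd e1 e2) : dpoly_scope.
Local Notation "e1 * e2" := (DMul e1 e2) : dpoly_scope.
Local Notation "c %:C" := (DCst c%R) (at level 2, format "c %:C") : dpoly_scope.

Section DPoly.
Context {R : realType}.
Implicit Types (rho : seq R) (e : dpoly R) (delta : seq (dpoly R)).

Fixpoint deval rho e : R :=
  match e with
  | DVar i => rho`_i
  | DCst c => c
  | DAdd e1 e2 => deval rho e1 + deval rho e2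
  | DMul e1 e2 => deval rho e1 * deval rho e2
  end.

Fixpoint dderiv delta e : dpoly R :=
  match e with
  | DVar i => nth (DCst 0) delta i
  | DCst c => DCst 0
  | DAdd e1 e2 => dderiv delta e1 + dderiv delta e2
  | DMul e1 e2 => e1 * dderiv delta e2 + e2 * dderiv delta e1
  end%DP.

Lemma is_derive_deval (V : normedModType R) (E : V -> seq R) delta q v :
  (forall i, is_derive q v (fun p => (E p)`_i)
                       (deval (E q) (nth (DCst 0) delta i))) ->
  forall e, is_derive q v (fun p => deval (E p) e) (deval (E q) (dderiv delta e)).
Proof.
move=> HE; elim=> [i|c|e1 IH1 e2 IH2|e1 IH1 e2 IH2] /=.
- exact: HE.
- exact: is_derive_cst.
- exact: is_deriveD.
- exact: is_deriveM.
Qed.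

Lemma continuous_deval (V : topologicalType) (E : V -> seq R) q :
  (forall i, {for q, continuous (fun p => (E p)`_i)}) ->
  forall e, {for q, continuous (fun p => deval (E p) e)}.
Proof.
move=> HE; elim=> [i|c|e1 IH1 e2 IH2|e1 IH1 e2 IH2] /=.
- exact: HE.
- exact: cvg_cst.
- exact: (@continuousD _ R^o V _ _ _ IH1 IH2).
- exact: (@continuousM R V _ _ _ IH1 IH2).
Qed.

Definition factor_expr (m : R) : dpoly R :=
  (1%:C + m%:C * (DVar 0 * DVar 0 + DVar 1 * DVar 1))%DP.

Lemma bcv_factorE (m x y : R) : bcv_factor m x y = deval [:: x; y] (factor_expr m).
Proof. by rewrite /bcv_factor !expr2. Qed.

(** The chart is open, so formulas valid where the factor is positive can be differentiated. *)
Lemma near_bcv_factor (V : topologicalType) (m : R) (X Y : V -> R) q :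
  {for q, continuous X} -> {for q, continuous Y} ->
  0 < bcv_factor m (X q) (Y q) ->
  \forall p \near q, 0 < bcv_factor m (X p) (Y p).
Proof.
move=> cX cY Fq.
have C : {for q, continuous (fun p => bcv_factor m (X p) (Y p))}.
  rewrite (_ : (fun p => _) = fun p => deval [:: X p; Y p] (factor_expr m)).
    by apply: continuous_deval => -[|[|[|i]]] //=; exact: cvg_cst.
  by apply/funext => p; rewrite bcv_factorE.
exact: (cvgr_gt _ C _ Fq).
Qed.

Lemma continuous_coord n (i : 'I_n) : continuous (fun p : 'rV[R]_n => p 0 i).
Proof.
by move=> p; apply: differentiable_continuous; exact: differentiable_coord.
Qed.

Lemma is_derive_coord n (q v : 'rV[R]_n) (i : 'I_n) (f : R -> R) (df : R) :
  is_derive (q 0 i) 1 f df ->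
  is_derive q v (fun p : 'rV[R]_n => f (p 0 i)) (v 0 i * df).
Proof.
move=> Hf.
have Hd : is_derive (q 0 i) (v 0 i) f (v 0 i * df).
  have Hdf : differentiable f (q 0 i) by apply/derivable1_diffP; case: Hf.
  apply: DeriveDef; first exact: diff_derivable.
  rewrite deriveE// -[X in 'd f _ X]mulr1 linearZ/=.
  by rewrite -deriveE// derive_val.
have E : (fun h : R => h^-1 *: (((fun p : 'rV[R]_n => f (p 0 i)) \o shift q) (h *: v)
          - f (q 0 i))) =
        (fun h : R => h^-1 *: ((f \o shift (q 0 i)) (h *: v 0 i) - f (q 0 i))).
  by apply/funext => h /=; rewrite !mxE.
case: Hd => H1 H2; apply: DeriveDef.
  by rewrite /derivable E.
by rewrite -H2 /derive E.
Qed.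

(** Moving along [v] leaves the [i]-th coordinate fixed, so the difference quotient is that of a
    constant, whatever [f] is. *)
Lemma is_derive_coord0 n (q v : 'rV[R]_n) (i : 'I_n) (f : R -> R) :
  v 0 i = 0 -> is_derive q v (fun p : 'rV[R]_n => f (p 0 i)) 0.
Proof.
move=> v0; have C := @is_derive_cst _ _ _ (f (q 0 i)) q v.
have E : (fun h : R => h^-1 *:
    (((fun p : 'rV[R]_n => f (p 0 i)) \o shift q) (h *: v) - f (q 0 i))) =
    (fun h : R => h^-1 *: ((cst (f (q 0 i)) \o shift q) (h *: v) - f (q 0 i))).
  by apply/funext => h /=; rewrite !mxE v0 mulr0 add0r.
by case: C => C1 C2; apply: DeriveDef; rewrite /derivable /derive E.
Qed.

Lemma is_derive_bcv_factorV (V : normedModType R) (m : R) (X Y : V -> R) q v dX dY :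
  is_derive q v X dX -> is_derive q v Y dY -> bcv_factor m (X q) (Y q) != 0 ->
  is_derive q v (fun p => (bcv_factor m (X p) (Y p))^-1)
    (- (2 * m) * (X q * dX + Y q * dY) * (bcv_factor m (X q) (Y q))^-1 ^+ 2).
Proof.
move=> HX HY Fn0.
have HF : is_derive q v (fun p => bcv_factor m (X p) (Y p))
    (2 * m * (X q * dX + Y q * dY)).
  have := @is_derive_deval V (fun p => [:: X p; Y p]) [:: dX%:C; dY%:C]%DP q v _
    (factor_expr m).
  have HE : forall i : nat, is_derive q v (fun p => [:: X p; Y p]`_i)
      (deval [:: X q; Y q] (nth (DCst 0) [:: dX%:C; dY%:C]%DP i)).
    case=> [|[|i]]//=; case: i => [|i]; exact: is_derive_cst.
  move=> /(_ HE) /= H.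
  rewrite (_ : (fun p => _) =
    fun p => 1 + m * (X p * X p + Y p * Y p)); last first.
    by apply/funext => p; rewrite bcv_factorE.
  by apply: (is_derive_eq H); ring.
apply: DeriveDef; first exact: derivableV.
rewrite deriveV// derive_val /= /GRing.scale/= exprVn; ring.
Qed.

Lemma is_derive_row n (V : normedModType R) (q v : V) (f : V -> 'rV[R]_n) (df : 'rV[R]_n) :
  (forall i, is_derive q v (fun p => f p 0 i) (df 0 i)) -> is_derive q v f df.
Proof.
move=> Hf; have D : derivable f q v.
  by apply/derivable_mxP => i j; rewrite ord1; case: (Hf j).
apply: DeriveDef => //; rewrite derive_mx//; apply/rowP => j; rewrite mxE.
by rewrite derive_val.
Qed.

Lemma is_derive_component n (V : normedModType R) (q v : V) (f : V -> 'rV[R]_n)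
  (df : 'rV[R]_n) : is_derive q v f df ->
  forall i, is_derive q v (fun p => f p 0 i) (df 0 i).
Proof.
case=> D <- i; apply: DeriveDef; first exact: ((derivable_mxP _ _ _).1 D).
by rewrite derive_mx// mxE.
Qed.

Lemma near_coord (n : nat) (p : 'rV[R]_n) (i : 'I_n) (P : R -> Prop) :
  (\forall s \near p 0 i, P s) -> {near p, forall q : 'rV[R]_n, P (q 0 i)}.
Proof. by move=> H; exact: (@continuous_coord n i p _ H). Qed.

End DPoly.

Section Continuity.
Context {R : realType}.
Variable m : R.

Lemma is_derive_continuous (f : R -> R) (s df : R) :
  is_derive s 1 f df -> {for s, continuous f}.
Proof. by case=> D _; apply: differentiable_continuous; apply/derivable1_diffP. Qed.

Lemma continuous_bcv_factorV (f g : R -> R) (s : R) :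
  {for s, continuous f} -> {for s, continuous g} -> 0 < bcv_factor m (f s) (g s) ->
  {for s, continuous (fun t => (bcv_factor m (f t) (g t))^-1)}.
Proof.
move=> cf cg F0; apply: cvgV; first exact: lt0r_neq0.
rewrite (_ : (fun t => _) = fun t => deval [:: f t; g t] (factor_expr m)); last first.
  by apply/funext => t; rewrite bcv_factorE.
by rewrite bcv_factorE; apply: continuous_deval => -[|[|[|i]]] //=; exact: cvg_cst.
Qed.

Lemma continuous_row (T : topologicalType) n (f : T -> 'rV[R]_n) p :
  (forall i, {for p, continuous (fun q => f q 0 i)}) -> {for p, continuous f}.
Proof.
move=> Hf A [P HP sub].
have : \forall q \near p, forall i, P 0 i (f q 0 i).
  by apply: filter_forall => i; apply: (Hf i); exact: HP.
apply: filterS => q Hq; apply: sub => i j; rewrite ord1; exact: Hq.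
Qed.

End Continuity.

(** * Connection and curvature of the BCV spaces *)

Section BCVChristoffel.
Context {R : realType}.
Variables (m l : R).
Local Notation F q := (bcv_factor m (q 0 0) (q 0 1)).
Local Notation G := (bcv_metric m l).
Implicit Types (q u v w : 'rV[R]_3).

Definition bcv_env q : seq R := [:: q 0 0; q 0 1; (F q)^-1].

Local Notation X := (DVar 0).
Local Notation Y := (DVar 1).
Local Notation U := (DVar 2).

Definition bcv_denv (i : nat) : seq (dpoly R) :=
  [:: (i == 0)%:R%:C; (i == 1)%:R%:C;
      (- (2 * m))%:C * (X * (i == 0)%:R%:C + Y * (i == 1)%:R%:C) * (U * U)]%DP.

Lemma coord_vecE n (i j : 'I_n) : (coord_vec i : 'rV[R]_n) 0 j = ((i : nat) == j)%:R.
Proof. by rewrite mxE eqxx eq_sym. Qed.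

Lemma is_derive_bcv q (i : 'I_3) (e : dpoly R) : F q != 0 ->
  is_derive q (coord_vec i) (fun p => deval (bcv_env p) e)
    (deval (bcv_env q) (dderiv (bcv_denv i) e)).
Proof.
move=> Fn0; apply: is_derive_deval => k.
have D (j : 'I_3) : is_derive q (coord_vec i) (fun p => p 0 j) ((i : nat) == j)%:R.
  apply: (is_derive_eq (is_derive_coord (f := id) (coord_vec i) (is_derive_id _ _))).
  by rewrite mulr1 coord_vecE.
case: k => [|[|[|k]]].
- exact: (D 0).
- exact: (D 1).
- by have /= H := is_derive_bcv_factorV (D 0) (D 1) Fn0; apply: (is_derive_eq H).
- by case: k => [|k] /=; exact: is_derive_cst.
Qed.

Definition form_expr (i : nat) : dpoly R :=
  match i with
  | 0 => (l / 2)%:C * (Y * U)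
  | 1 => (- (l / 2))%:C * (X * U)
  | _ => 1%:C
  end%DP.

Lemma bcv_formE q (i : 'I_3) : bcv_form m l q 0 i = deval (bcv_env q) (form_expr i).
Proof. by case: i => [[|[|[|//]]] hi]; rewrite mxE /= ?mulNr. Qed.

Definition metric_expr (i j : nat) : dpoly R :=
  (((i == j) && (i < 2)%N)%:R%:C * (U * U) + form_expr i * form_expr j)%DP.

Lemma bcv_metricE q (i j : 'I_3) : G q i j = deval (bcv_env q) (metric_expr i j).
Proof.
rewrite [LHS]mxE [X in _ + X]mxE big_ord1 [X in X * _]mxE !bcv_formE.
rewrite !mxE /= -exprVn expr2; congr (_ + _).
by case: i => [[|[|[|//]]] hi]; case: j => [[|[|[|//]]] hj]; rewrite /= ?mulr0 ?mul0r ?mulr1 ?mul1r.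
Qed.

(** Sum of the squares of the orthonormal frame F d_x - (l/2) y d_z, F d_y + (l/2) x d_z, d_z. *)
Definition bcv_cometric q : 'M[R]_3 := \matrix_(i, j)
  match (i : nat), (j : nat) with
  | 0, 0 | 1, 1 => F q ^+ 2
  | 0, 2 | 2, 0 => - (l / 2) * F q * q 0 1
  | 1, 2 | 2, 1 => l / 2 * F q * q 0 0
  | 2, 2 => 1 + l ^+ 2 / 4 * (q 0 0 ^+ 2 + q 0 1 ^+ 2)
  | _, _ => 0
  end.

Lemma invmx_bcv_metric q : F q != 0 -> invmx (G q) = bcv_cometric q.
Proof.
move=> Fn0; have H : G q *m bcv_cometric q = 1%:M.
  apply/matrixP => i j; rewrite mxE !big_ord_recr big_ord0 /= !bcv_metricE !mxE.
  by case: i => [[|[|[|//]]] hi]; case: j => [[|[|[|//]]] hj] /=; field.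
have [gu _] := mulmx1_unit H.
by rewrite -[LHS]mulmx1 -H mulmxA mulVmx// mul1mx.
Qed.

(* Gamma(v, w).  Its horizontal part is that of the conformal metric of the base
   plus (l/2) (eta(v) w^+ + eta(w) v^+), where (a, b)^+ = (b, -a); its eta-component
   is half the symmetrized derivative of eta, because xi is a Killing field. *)
Section ChristoffelExpr.
Variables (v w : nat -> R).
Let vx := (v 0)%:C%DP. Let vy := (v 1)%:C%DP.
Let wx := (w 0)%:C%DP. Let wy := (w 1)%:C%DP.
Let eta (u : nat -> R) : dpoly R :=
  (form_expr 0 * (u 0)%:C + form_expr 1 * (u 1)%:C + (u 2)%:C)%DP.
Let xv := (X * vx + Y * vy)%DP.
Let xw := (X * wx + Y * wy)%DP.

Definition christoffel_expr0 :=
  ((- (2 * m))%:C * U * (xv * wx + xw * vx + (-1)%:C * X * (vx * wx + vy * wy))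
  + (l / 2)%:C * (eta v * wy + eta w * vy))%DP.
Definition christoffel_expr1 :=
  ((- (2 * m))%:C * U * (xv * wy + xw * vy + (-1)%:C * Y * (vx * wx + vy * wy))
  + (- (l / 2))%:C * (eta v * wx + eta w * vx))%DP.
Definition christoffel_expr2 :=
  ((- (l / 2 * m))%:C * (U * U) *
   (xv * (Y * wx + (-1)%:C * X * wy) + xw * (Y * vx + (-1)%:C * X * vy))
   + (- (l / 2))%:C * U * (Y * christoffel_expr0 + (-1)%:C * X * christoffel_expr1))%DP.

Definition christoffel_expr (k : nat) :=
  match k with 0 => christoffel_expr0 | 1 => christoffel_expr1 | _ => christoffel_expr2 end.
End ChristoffelExpr.

Definition unit_at (i j : nat) : R := (i == j)%:R.

Lemma christoffel_bcv q (k i j : 'I_3) : F q != 0 ->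
  christoffel G k i j q = deval (bcv_env q) (christoffel_expr (unit_at i) (unit_at j) k).
Proof.
move=> Fn0; rewrite /christoffel invmx_bcv_metric//.
have D (a b c : 'I_3) : 'D_(coord_vec c) (fun q' => G q' a b) q =
    deval (bcv_env q) (dderiv (bcv_denv c) (metric_expr a b)).
  rewrite (_ : (fun q' => _) = fun p => deval (bcv_env p) (metric_expr a b)).
    by have [_ ->] := is_derive_bcv c (metric_expr a b) Fn0.
  by apply/funext => p; rewrite bcv_metricE.
under eq_bigr => a _ do rewrite !D mxE.
rewrite !big_ord_recr big_ord0 /=; clear D; rewrite /bcv_env.
move: Fn0; move: (q 0 0) (q 0 1) => x y Fn0.
case: i => [[|[|[|//]]] hi]; case: j => [[|[|[|//]]] hj]; case: k => [[|[|[|//]]] hk] /=;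
 rewrite /unit_at /=; rewrite /bcv_factor in Fn0 *; field; exact: Fn0.
Qed.

End BCVChristoffel.

(** * Riemann tensor of the BCV spaces *)

Section BCVRiemann.
Context {R : realType}.
Variables (m l : R).
Local Notation F q := (bcv_factor m ((q : 'rV[R]_3) 0 0) ((q : 'rV[R]_3) 0 1)).
Local Notation G := (bcv_metric m l).
Implicit Types (q u v w : 'rV[R]_3).

(* 4 m - 3 l^2/4 is the sectional curvature of the horizontal planes, and adding
   l^2 - 4 m gives l^2/4, that of the vertical ones. *)
Definition bcv_riemann q (a i j k : 'I_3) : R :=
  (4 * m - 3 / 4 * l ^+ 2)
    * (G q j k * (i == a)%:R - G q i k * (j == a)%:R)
  + (l ^+ 2 - 4 * m) *
   (bcv_form m l q 0 j * bcv_form m l q 0 k * (i == a)%:R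
    - bcv_form m l q 0 i * bcv_form m l q 0 k * (j == a)%:R
    + (G q j k * bcv_form m l q 0 i - G q i k * bcv_form m l q 0 j)
       * (ord_max == a)%:R).

Lemma riemannC n (g : 'rV[R]_n -> 'M[R]_n) (q : 'rV[R]_n) (a i j k : 'I_n) :
  riemann g a j i k q = - riemann g a i j k q.
Proof.
rewrite /riemann opprD opprB -sumrN; congr (_ + _).
by apply: eq_bigr => b _; rewrite opprB.
Qed.

Let riemann_lt q (a i j k : 'I_3) : 0 < F q -> (i < j)%N ->
  riemann G a i j k q = bcv_riemann q a i j k.
Proof.
move=> Fq ij; have Fn0 := lt0r_neq0 Fq.
have Fnear := near_bcv_factor (@continuous_coord R 3 0 q) (@continuous_coord R 3 1 q) Fq.
have D (b : 'I_3) (i' j' k' : 'I_3) :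
    'D_(coord_vec b) (christoffel G k' i' j') q =
    deval (bcv_env m q) (dderiv (bcv_denv m b)
       (christoffel_expr m l (unit_at i') (unit_at j') k')).
  have [_ <-] := is_derive_bcv b (christoffel_expr m l (unit_at i') (unit_at j') k') Fn0.
  apply: near_eq_derive; near=> p; apply: christoffel_bcv; apply: lt0r_neq0.
  by near: p.
rewrite /riemann !D; under eq_bigr => b _ do rewrite !christoffel_bcv//.
clear D; rewrite /bcv_riemann !bcv_metricE !bcv_formE.
rewrite !big_ord_recr big_ord0 /bcv_env.
(* This is F^-1 F = 1, solved for its monomial in [q 0 0 ^+ 2]. Once F^-1 is abstracted to [u], it
   is the relation by which [field:] reduces. *)
have Hu : m * (F q)^-1 * q 0 0 ^+ 2 = 1 - (F q)^-1 - m * (F q)^-1 * q 0 1 ^+ 2.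
  by have := mulVf Fn0; rewrite [X in _ * X = _]/bcv_factor => <-; ring.
move: (q 0 0) (q 0 1) (F q)^-1 Hu; clear Fnear Fn0 Fq q => x y u Hu.
move: ij; case: i => [[|[|[|//]]] hi]; case: j => [[|[|[|//]]] hj] // _;
case: k => [[|[|[|//]]] hk]; case: a => [[|[|[|//]]] ha] => /=; rewrite ?eqxx;
 rewrite /unit_at /=; by field: Hu.
Unshelve. all: by end_near.
Qed.

Lemma riemannE q (a i j k : 'I_3) : 0 < F q ->
  riemann G a i j k q = bcv_riemann q a i j k.
Proof.
move=> Fq; have [ij|ji|/val_inj ->] := ltngtP i j.
- exact: riemann_lt.
- by rewrite riemannC riemann_lt// /bcv_riemann; ring.
- have -> : riemann G a j j k q = 0.
    by rewrite /riemann subrr add0r big1// => b _; rewrite subrr.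
  by rewrite /bcv_riemann; ring.
Qed.

End BCVRiemann.

Section BCVConstantCurvature.
Context {R : realType}.
Variables (m l : R).
Local Notation F q := (bcv_factor m ((q : 'rV[R]_3) 0 0) ((q : 'rV[R]_3) 0 1)).
Local Notation G := (bcv_metric m l).
Implicit Types (q u v w : 'rV[R]_3).

Definition seq3 v : seq R := [:: v 0 0; v 0 1; v 0 ord_max].

Lemma christoffel_sum q v w (k : 'I_3) : F q != 0 ->
  \sum_(i < 3) \sum_(j < 3) christoffel G k i j q * v 0 i * w 0 j =
  deval (bcv_env m q) (christoffel_expr m l (nth 0 (seq3 v)) (nth 0 (seq3 w)) k).
Proof.
move=> Fn0; under eq_bigr do under eq_bigr do rewrite christoffel_bcv//.
rewrite !big_ord3 /unit_at.
by elim/ord3_ind: k => /=; ring.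
Qed.

Definition bcv_eta q v : R := (bcv_form m l q *m v^T) 0 0.

Lemma curvatureE q u v w : 0 < F q ->
  curvature G q u v w =
    (4 * m - 3 / 4 * l ^+ 2)
      *: (inner (G q) v w *: u - inner (G q) u w *: v)
    + (l ^+ 2 - 4 * m) *:
      ((bcv_eta q v * bcv_eta q w) *: u - (bcv_eta q u * bcv_eta q w) *: v
       + (inner (G q) v w * bcv_eta q u - inner (G q) u w * bcv_eta q v)
           *: coord_vec ord_max).
Proof.
move=> Fq; apply/rowP => a.
rewrite [LHS]mxE.
under eq_bigr do under eq_bigr do under eq_bigr do rewrite riemannE//.
rewrite /inner /bcv_eta /bcv_riemann !mxE !big_ord3.
rewrite !mxE !big_ord3 !mxE.
elim/ord3_ind: a => /=; ring.
Qed.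

End BCVConstantCurvature.

(** * Connection along a Hopf cylinder *)

Section HopfCylinder.
Context {R : realType}.
Variables (m l : R) (gamma : R -> 'rV[R]_2).
Local Notation G := (bcv_metric m l).
Local Notation phi := (hopf_cylinder gamma).
Implicit Types (p : 'rV[R]_2) (e : dpoly R).

Definition curve_env (s : R) : seq R :=
  [:: gamma s 0 0; gamma s 0 1;
      (bcv_factor m (gamma s 0 0) (gamma s 0 1))^-1;
      derive1 gamma s 0 0; derive1 gamma s 0 1].

Local Notation X := (DVar 0).
Local Notation Y := (DVar 1).
Local Notation U := (DVar 2).
Local Notation A := (DVar 3).
Local Notation B := (DVar 4).
Local Notation "e1 - e2" := (e1 + (-1)%:C * e2)%DP : dpoly_scope.

(* The acceleration of a unit speed curve of curvature [k], in coordinates. *)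
Definition accel_expr (k : R) (i : nat) : dpoly R :=
  let rad := (X * A + Y * B)%DP in
  let rot := (X * B - Y * A)%DP in
  if i == 0 then ((2 * m)%:C * U * (A * rad - B * rot) - k%:C * B)%DP
  else ((2 * m)%:C * U * (B * rad + A * rot) + k%:C * A)%DP.

(** Being pointwise, the condition also covers end points of an interval and curvatures that vary
    with [s]. The last field says that the covariant derivative of the velocity is [k] times the
    rotated velocity. *)
Record curved_at (k s : R) : Prop := CurvedAt {
  curved_factor_gt0 : 0 < bcv_factor m (gamma s 0 0) (gamma s 0 1);
  curved_derivable : \forall t \near s, derivable gamma t 1;
  curved_speed : (derive1 gamma s 0 0) ^+ 2 + (derive1 gamma s 0 1) ^+ 2 =
    bcv_factor m (gamma s 0 0) (gamma s 0 1) ^+ 2;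
  curved_accel : is_derive s 1 (derive1 gamma)
    (\row_i deval (curve_env s) (accel_expr k i)) }.

Definition henv p := curve_env (p 0 0).

(** Derivatives of [henv] along d_s ([a] = 0) and d_t ([a] = 1); the factor kills the latter, as all
    entries are functions of s. Second derivatives of the curve are eliminated through
    [accel_expr]. *)
Definition hdenv (k : R) (a : nat) : seq (dpoly R) :=
  [seq (a == 0)%:R%:C * e | e <-
    [:: A; B; (- (2 * m))%:C * (X * A + Y * B) * (U * U);
        accel_expr k 0; accel_expr k 1]]%DP.

Lemma is_derive_hopf k p (a : 'I_2) e : curved_at k (p 0 0) ->
  is_derive p (coord_vec a) (fun q => deval (henv q) e)
    (deval (henv p) (dderiv (hdenv k a) e)).
Proof.
case=> Fgt0 Hd Hs Ha; apply: is_derive_deval => i.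
have Hg : is_derive (p 0 0) 1 gamma (derive1 gamma (p 0 0)).
  by rewrite derive1E; apply: derivableP; exact: nbhs_singleton Hd.
have a0 : coord_vec a 0 0 = ((a : nat) == 0)%:R :> R by rewrite coord_vecE.
have DX := is_derive_coord (coord_vec a) (is_derive_component Hg 0).
have DY := is_derive_coord (coord_vec a) (is_derive_component Hg 1).
have DA := is_derive_coord (coord_vec a) (is_derive_component Ha 0).
have DB := is_derive_coord (coord_vec a) (is_derive_component Ha 1).
rewrite a0 in DX DY DA DB.
case: i => [|[|[|[|[|i]]]]].
- exact: DX.
- exact: DY.
- have H := is_derive_bcv_factorV DX DY (lt0r_neq0 Fgt0).
  by apply: (is_derive_eq H) => /=; ring.
- by apply: (is_derive_eq DA); rewrite mxE.
- by apply: (is_derive_eq DB); rewrite mxE.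
- by rewrite /= nth_default//; apply: (is_derive_eq (is_derive_cst _ _ _)); case: i.
Qed.

(* theta = g(d_s, xi), so that d_s = T + theta xi. *)
Definition theta_expr : dpoly R := ((l / 2)%:C * U * (Y * A - X * B))%DP.
Definition tangent_expr (i : nat) : dpoly R :=
  nth 0%:C%DP [:: A; B; (-1)%:C * theta_expr]%DP i.
Definition normal_expr (i : nat) : dpoly R :=
  nth 0%:C%DP [:: (-1)%:C * B; A; (l / 2)%:C * U * (X * A + Y * B)]%DP i.

(* The value at [p] of [a T + b N + c xi], where [T] and [N] are the horizontal
   lifts of the unit tangent and of the unit normal of the curve. *)
Definition frame p (a b c : R) : 'rV[R]_3 :=
  \row_i (a * deval (henv p) (tangent_expr i)
        + b * deval (henv p) (normal_expr i) + c * ((i : nat) == 2)%:R).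

Definition frame_field (a b c : dpoly R) p :=
  frame p (deval (henv p) a) (deval (henv p) b) (deval (henv p) c).

Definition theta p := deval (henv p) theta_expr.

Lemma nabla_near_eq (a : 'I_2) (V W : 'rV[R]_2 -> 'rV[R]_3) p :
  (\forall q \near p, V q = W q) -> nabla G phi a V p = nabla G phi a W p.
Proof.
move=> VW; rewrite /nabla (near_eq_derive _ VW); congr (_ + _).
by apply/rowP => i; rewrite !mxE (nbhs_singleton VW).
Qed.

(** The coordinate lift (x', y', 0) of the velocity is not horizontal: its vertical component is
    theta. *)
Lemma dmap0E p : derivable gamma (p 0 0) 1 ->
  dmap phi 0 p = frame_field 1%:C 0%:C theta_expr p.
Proof.
move=> Hd.
have Hg : is_derive (p 0 0) 1 gamma (derive1 gamma (p 0 0)).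
  by rewrite derive1E; exact: derivableP.
have DX := is_derive_coord (coord_vec 0) (is_derive_component Hg 0).
have DY := is_derive_coord (coord_vec 0) (is_derive_component Hg 1).
have DT : is_derive p (coord_vec 0) (fun q : 'rV[R]_2 => q 0 1) 0.
  apply: (is_derive_eq (is_derive_coord (f := id) (coord_vec 0) (is_derive_id _ _))).
  by rewrite mulr1 coord_vecE.
rewrite /dmap.
suff [_ ->] : is_derive p (coord_vec 0) phi (frame_field 1%:C 0%:C theta_expr p) by [].
apply: is_derive_row; elim/ord3_ind.
- apply: (is_derive_eq (near_eq_is_derive _ DX)).
    by apply: filterE => q; rewrite mxE.
  by rewrite coord_vecE !mxE /=; ring.
- apply: (is_derive_eq (near_eq_is_derive _ DY)).
    by apply: filterE => q; rewrite mxE.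
  by rewrite coord_vecE !mxE /=; ring.
- apply: (is_derive_eq (near_eq_is_derive _ DT)).
    by apply: filterE => q; rewrite mxE.
  by rewrite !mxE /=; ring.
Qed.

Lemma dmap1E p : dmap phi 1 p = frame_field 0%:C 0%:C 1%:C p.
Proof.
have DT : is_derive p (coord_vec 1) (fun q : 'rV[R]_2 => q 0 1) 1.
  apply: (is_derive_eq (is_derive_coord (f := id) (coord_vec 1) (is_derive_id _ _))).
  by rewrite mulr1 coord_vecE.
have DC (f : R -> R) : is_derive p (coord_vec 1) (fun q : 'rV[R]_2 => f (q 0 0)) 0.
  by apply: is_derive_coord0; rewrite coord_vecE.
rewrite /dmap.
suff [_ ->] : is_derive p (coord_vec 1) phi (frame_field 0%:C 0%:C 1%:C p) by [].
apply: is_derive_row; elim/ord3_ind.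
- apply: (is_derive_eq (near_eq_is_derive _ (DC (fun s => gamma s 0 0)))).
    by apply: filterE => q; rewrite mxE.
  by rewrite !mxE /=; ring.
- apply: (is_derive_eq (near_eq_is_derive _ (DC (fun s => gamma s 0 1)))).
    by apply: filterE => q; rewrite mxE.
  by rewrite !mxE /=; ring.
- apply: (is_derive_eq (near_eq_is_derive _ DT)).
    by apply: filterE => q; rewrite mxE.
  by rewrite !mxE /=; ring.
Qed.

End HopfCylinder.

Section HopfConnection.
Context {R : realType}.
Variables (m l : R) (gamma : R -> 'rV[R]_2).
Local Notation G := (bcv_metric m l).
Local Notation phi := (hopf_cylinder gamma).
Implicit Types (p : 'rV[R]_2) (e : dpoly R).
Local Notation U := (DVar 2).
Local Notation A := (DVar 3).
Local Notation B := (DVar 4).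
Local Notation curved_at := (curved_at m gamma).
Local Notation henv := (henv m gamma).
Local Notation theta := (theta m l gamma).
Local Notation frame := (frame m l gamma).
Local Notation frame_field := (frame_field m l gamma).

Lemma bcv_env_hopf p : bcv_env m (phi p) = take 3 (henv p).
Proof. by rewrite /bcv_env !mxE. Qed.

(** Squared length of the projected velocity, equal to 1 by [speed1]. It is kept as a polynomial
    because unit speed is known only at the point considered, while the induced metric is
    differentiated there. *)
Definition speed_expr : dpoly R := (U * U * (A * A + B * B))%DP.

Lemma inner_frameE p a b c a' b' c' :
  inner (G (phi p)) (frame p a b c) (frame p a' b' c') =
  deval (henv p) speed_expr * (a * a' + b * b') + c * c'.
Proof.
rewrite /inner !mxE !big_ord3 !mxE !big_ord3 !bcv_metricE !bcv_env_hopf !mxE /=.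
ring.
Qed.

Lemma bcv_eta_frame p a b c : bcv_eta m l (phi p) (frame p a b c) = c.
Proof.
rewrite /bcv_eta !mxE !big_ord3 !bcv_formE !bcv_env_hopf !mxE /=; ring.
Qed.

Definition imetric_expr (a b : nat) : dpoly R :=
  match a, b with
  | 0, 0 => (speed_expr + theta_expr l * theta_expr l)%DP
  | 1, 1 => 1%:C%DP
  | _, _ => theta_expr l
  end.

Lemma induced_metricE p (a b : 'I_2) : derivable gamma (p 0 0) 1 ->
  induced_metric G phi p a b = deval (henv p) (imetric_expr a b).
Proof.
move=> Hd; rewrite mxE; elim/ord2_ind: a; elim/ord2_ind: b;
by rewrite ?(dmap0E m l) ?(dmap1E m l)// /frame_field inner_frameE /=; ring.
Qed.

Section AtPoint.
Variables (k : R) (p : 'rV[R]_2).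
Hypothesis Hp : curved_at k (p 0 0).

Let der_p : derivable gamma (p 0 0) 1.
Proof. by have [_ H _ _] := Hp; exact: nbhs_singleton H. Qed.

Let near_der : {near p, forall q : 'rV[R]_2, derivable gamma (q 0 0) 1}.
Proof.
by have [_ H _ _] := Hp; exact: (@near_coord R 2 p 0 (fun s => derivable gamma s 1) H).
Qed.

Lemma speed1 : deval (henv p) speed_expr = 1.
Proof.
have [F0 _ Hs _] := Hp; rewrite /= -!expr2 Hs -exprMn mulVf ?expr1n//.
exact: lt0r_neq0.
Qed.

Lemma inner_frame a b c a' b' c' :
  inner (G (phi p)) (frame p a b c) (frame p a' b' c') = a * a' + b * b' + c * c'.
Proof. by rewrite inner_frameE speed1 mul1r. Qed.

Lemma induced_metric_at (a b : 'I_2) : induced_metric G phi p a b =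
  if a == b then (if a == 0 then 1 + theta p ^+ 2 else 1) else theta p.
Proof.
rewrite induced_metricE//; elim/ord2_ind: a; elim/ord2_ind: b => //.
by rewrite -speed1 /= -!expr2.
Qed.

Lemma invmx_induced : invmx (induced_metric G phi p) =
  \matrix_(a < 2, b < 2) if a == b then
     (if a == 0 then 1 else 1 + theta p ^+ 2) else - theta p.
Proof.
set M := (RHS); have H : induced_metric G phi p *m M = 1%:M.
  apply/matrixP => a b; rewrite mxE big_ord2 !induced_metric_at !mxE.
  by elim/ord2_ind: a; elim/ord2_ind: b => /=; ring.
have [gu _] := mulmx1_unit H.
by rewrite -[LHS]mulmx1 -H mulmxA mulVmx// mul1mx.
Qed.

Lemma traceE (T : 'I_2 -> 'I_2 -> 'rV[R]_3) : trace G phi p T =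
  T 0 0 - theta p *: (T 0 1 + T 1 0) + (1 + theta p ^+ 2) *: T 1 1.
Proof.
rewrite /trace invmx_induced !big_ord2 !mxE /= scale1r; apply/rowP => i; rewrite !mxE; ring.
Qed.

Definition dtheta := deval (henv p) (dderiv (hdenv m k 0) (theta_expr l)).

(** The induced metric is ds^2 + (dt + theta ds)^2 with theta a function of s, so only Gamma^1_00 =
    theta' survives. The derivative of [speed_expr] vanishes by the form of [accel_expr]. *)
Lemma christoffel_induced (c a b : 'I_2) :
  christoffel (induced_metric G phi) c a b p =
  if [&& c == 1, a == 0 & b == 0] then dtheta else 0.
Proof.
have D (i a' b' : 'I_2) :
   'D_(coord_vec i) (fun q => induced_metric G phi q a' b') p =
   deval (henv p) (dderiv (hdenv m k i) (imetric_expr a' b')).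
  have [_ <-] := is_derive_hopf i (imetric_expr a' b') Hp.
  apply: near_eq_derive; near=> q; apply: induced_metricE.
  by near: q.
rewrite /christoffel invmx_induced big_ord2 !D !mxE; clear D.
rewrite /dtheta /theta.
have Fn0 : bcv_factor m (gamma (p 0 0) 0 0) (gamma (p 0 0) 0 1) != 0.
  by apply: lt0r_neq0; have [] := Hp.
by elim/ord2_ind: c; elim/ord2_ind: a; elim/ord2_ind: b => /=; field.
Unshelve. all: by end_near.
Qed.

Definition component_expr (a b c : dpoly R) (i : nat) : dpoly R :=
  (a * tangent_expr l i + b * normal_expr l i + c * (i == 2)%:R%:C)%DP.

Lemma nabla_frame_field (d : 'I_2) (a b c : dpoly R) (i : 'I_3) :
  nabla G phi d (frame_field a b c) p 0 i =
  deval (henv p) (dderiv (hdenv m k d) (component_expr a b c i))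
  + deval (take 3 (henv p))
     (christoffel_expr m l (nth 0 (seq3 (dmap phi d p))) (nth 0 (seq3 (frame_field a b c p))) i).
Proof.
have [F0 _ _ _] := Hp.
have D : is_derive p (coord_vec d) (frame_field a b c)
   (\row_j deval (henv p) (dderiv (hdenv m k d) (component_expr a b c j))).
  apply: is_derive_row => j; rewrite mxE.
  apply: near_eq_is_derive (is_derive_hopf d (component_expr a b c j) Hp).
  by apply: filterE => q; rewrite mxE.
rewrite /nabla mxE; have [_ ->] := D; rewrite mxE mxE christoffel_sum; last first.
  by rewrite !mxE; exact: lt0r_neq0.
by rewrite bcv_env_hopf.
Qed.

(* The leading monomials [m x^2] and [u^2 a^2] are coprime: oriented like this,
   the two relations are a Groebner basis, as the tactic [field:] needs. *)
Let relations : let x := gamma (p 0 0) 0 0 in let y := gamma (p 0 0) 0 1 in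
  let u := (bcv_factor m x y)^-1 in
  let a := derive1 gamma (p 0 0) 0 0 in let b := derive1 gamma (p 0 0) 0 1 in
  m * x ^+ 2 = u * a ^+ 2 + u * b ^+ 2 - 1 - m * y ^+ 2 /\ u ^+ 2 * a ^+ 2 = 1 - u ^+ 2 * b ^+ 2.
Proof.
have [F0 _ Hs _] := Hp; move=> x y u a b; split.
  have : bcv_factor m x y = u * (a ^+ 2 + b ^+ 2).
    by rewrite Hs expr2 mulKf//; exact: lt0r_neq0.
  by rewrite mulrDr => <-; rewrite /bcv_factor; ring.
by rewrite -speed1 /= -/x -/y -/u -/a -/b; ring.
Qed.

(** Since d_s = T + theta xi, the rules for nabla_T and nabla_xi combine: nabla_xi T = - (l/2) N and
    nabla_xi N = (l/2) T turn k into k - (l/2) theta. *)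
Lemma nabla_frame0 (a b c : dpoly R) :
  nabla G phi 0 (frame_field a b c) p =
  frame p
   (deval (henv p) (dderiv (hdenv m k 0) a) - (k - l / 2 * theta p) * deval (henv p) b)
   (deval (henv p) (dderiv (hdenv m k 0) b) + (k - l / 2 * theta p) * deval (henv p) a
     - l / 2 * deval (henv p) c)
   (deval (henv p) (dderiv (hdenv m k 0) c) + l / 2 * deval (henv p) b).
Proof.
apply/rowP => i; rewrite nabla_frame_field (dmap0E m l)// /theta.
rewrite [frame]lock /seq3 /frame_field -lock !mxE.
have [H1 H2] := relations.
elim/ord3_ind: i => /=.
all: move: H1 H2; set x := gamma _ 0 0; set y := gamma _ 0 1; set u := (bcv_factor _ _ _)^-1;
 set a1 := derive1 gamma _ 0 0; set b1 := derive1 gamma _ 0 1;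
 move: x y u a1 b1 => x y u a1 b1 H1 H2.
all: by field: H1 H2.
Qed.

Lemma vertical_derivative q e : deval (henv q) (dderiv (hdenv m k 1) e) = 0.
Proof.
elim: e => [i|r|e1 IH1 e2 IH2|e1 IH1 e2 IH2] //=; last 2 first.
- by rewrite IH1 IH2 addr0.
- by rewrite IH1 IH2 !mulr0 addr0.
by case: i => [|[|[|[|[|i]]]]] /=; rewrite ?mul0r// nth_nil.
Qed.

Lemma nabla_frame1 (a b c : dpoly R) :
  nabla G phi 1 (frame_field a b c) p =
  frame p (l / 2 * deval (henv p) b) (- (l / 2 * deval (henv p) a)) 0.
Proof.
apply/rowP => i; rewrite nabla_frame_field vertical_derivative add0r (dmap1E m l) /theta.
rewrite [frame]lock /seq3 /frame_field -lock !mxE.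
have [H1 H2] := relations.
elim/ord3_ind: i => /=.
all: move: H1 H2; set x := gamma _ 0 0; set y := gamma _ 0 1; set u := (bcv_factor _ _ _)^-1;
 set a1 := derive1 gamma _ 0 0; set b1 := derive1 gamma _ 0 1;
 move: x y u a1 b1 => x y u a1 b1 H1 H2.
all: by field: H1 H2.
Qed.

End AtPoint.
End HopfConnection.

(** * Tension field, curvature terms and iterated rough Laplacians *)

Section HopfTension.
Context {R : realType}.
Variables (m l : R) (gamma : R -> 'rV[R]_2).
Local Notation G := (bcv_metric m l).
Local Notation phi := (hopf_cylinder gamma).
Implicit Types (p : 'rV[R]_2) (e : dpoly R).
Local Notation curved_at := (curved_at m gamma).
Local Notation henv := (henv m gamma).
Local Notation theta := (theta m l gamma).
Local Notation frame := (frame m l gamma).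
Local Notation frame_field := (frame_field m l gamma).

Lemma frameD p a b c a' b' c' :
  frame p a b c + frame p a' b' c' = frame p (a + a') (b + b') (c + c').
Proof. by apply/rowP => i; rewrite !mxE; ring. Qed.

Lemma frameZ p t a b c : t *: frame p a b c = frame p (t * a) (t * b) (t * c).
Proof. by apply/rowP => i; rewrite !mxE; ring. Qed.

Lemma frameN p a b c : - frame p a b c = frame p (- a) (- b) (- c).
Proof. by apply/rowP => i; rewrite !mxE; ring. Qed.

Lemma frame_vertical p : coord_vec ord_max = frame p 0 0 1.
Proof. by apply/rowP; elim/ord3_ind; rewrite coord_vecE !mxE /=; ring. Qed.

Definition frameE := (frameN, frameZ, frameD).

Section AtPoint.
Variables (k : R) (p : 'rV[R]_2).
Hypothesis Hp : curved_at k (p 0 0).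

Let Fn0 : bcv_factor m (gamma (p 0 0) 0 0) (gamma (p 0 0) 0 1) != 0.
Proof. by apply: lt0r_neq0; have [] := Hp. Qed.

Lemma dmap_curved : dmap phi 0 p = frame p 1 0 (theta p).
Proof.
by rewrite (dmap0E m l)//; have [_ H _ _] := Hp; exact: nbhs_singleton H.
Qed.

Lemma trace_hessian (T : 'I_2 -> 'I_2 -> 'rV[R]_3) (W : 'I_2 -> 'rV[R]_3) :
  trace G phi p (fun a b => T a b
     - \sum_(c < 2) christoffel (induced_metric G phi) c a b p *: W c) =
  T 0 0 - dtheta m l gamma k p *: W 1 - theta p *: (T 0 1 + T 1 0)
  + (1 + theta p ^+ 2) *: T 1 1.
Proof.
rewrite (traceE _ Hp) !big_ord2 !(christoffel_induced _ Hp) /=.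
by rewrite !scale0r !add0r !subr0.
Qed.

(** In the orthonormal frame T, xi the second fundamental form has B(T, T) = k N and B(xi, xi) = 0.
    Here [k] is the curvature at this one point and may vary along the curve. *)
Lemma tension_hopf : tension G phi p = frame p 0 k 0.
Proof.
have Hd (d : 'I_2) : nabla G phi d (dmap phi 0) p =
    nabla G phi d (frame_field 1%:C%DP 0%:C%DP (theta_expr l)) p.
  apply: nabla_near_eq; have [_ H _ _] := Hp.
  apply: filterS (@near_coord R 2 p 0 _ H) => q; exact: dmap0E.
have Hd1 (d : 'I_2) : nabla G phi d (dmap phi 1) p =
    nabla G phi d (frame_field 0%:C%DP 0%:C%DP 1%:C%DP) p.
  by apply: nabla_near_eq; apply: filterE => q; exact: dmap1E.
rewrite [LHS](trace_hessian (fun a b => nabla G phi a (dmap phi b) p)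
                           (fun c => dmap phi c p)).
have E0 := dmap_curved; have E1 := dmap1E m l gamma p.
move: (dmap phi 0) (dmap phi 1) Hd Hd1 E0 E1 => D0 D1 Hd Hd1 E0 E1.
rewrite !Hd !Hd1 !(nabla_frame0 _ Hp) !(nabla_frame1 _ Hp) E1.
rewrite /frame_field !frameE /dtheta.
by congr frame; rewrite /theta /=; field.
Qed.

Lemma curvature_frame a b c a' b' c' a'' b'' c'' :
  curvature G (phi p) (frame p a b c) (frame p a' b' c') (frame p a'' b'' c'') =
  let vw := a' * a'' + b' * b'' + c' * c'' in
  let uw := a * a'' + b * b'' + c * c'' in
  let K := 4 * m - 3 / 4 * l ^+ 2 in
  let L := l ^+ 2 - 4 * m in
  frame p (K * (vw * a - uw * a') + L * (c' * c'' * a - c * c'' * a'))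
          (K * (vw * b - uw * b') + L * (c' * c'' * b - c * c'' * b'))
          (K * (vw * c - uw * c') + L * (c' * c'' * c - c * c'' * c' + (vw * c - uw * c'))).
Proof.
rewrite curvatureE; last by rewrite !mxE; have [] := Hp.
rewrite !(inner_frame _ Hp) !bcv_eta_frame (frame_vertical p) !frameE /=.
by congr frame; ring.
Qed.

(** R(N, T) T = K N and R(N, xi) xi = (l^2/4) N, and K + l^2/4 = 4 m - l^2/2. *)
Lemma ricci_normal V b : V p = frame p 0 b 0 ->
  ricci_term G phi V p = frame p 0 (b * (4 * m - l ^+ 2 / 2)) 0.
Proof.
move=> HV; rewrite /ricci_term (traceE _ Hp) HV dmap_curved (dmap1E m l).
rewrite /frame_field !curvature_frame /= !frameE.
by congr frame; field.
Qed.

Lemma rough_laplacianE V a00 a01 a10 a11 b1 :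
  nabla G phi 0 (nabla G phi 0 V) p = a00 ->
  nabla G phi 0 (nabla G phi 1 V) p = a01 ->
  nabla G phi 1 (nabla G phi 0 V) p = a10 ->
  nabla G phi 1 (nabla G phi 1 V) p = a11 ->
  nabla G phi 1 V p = b1 ->
  rough_laplacian G phi V p = - (a00 - dtheta m l gamma k p *: b1
    - theta p *: (a01 + a10) + (1 + theta p ^+ 2) *: a11).
Proof.
move=> <- <- <- <- <-; congr (- _).
exact: (trace_hessian (fun a b => nabla G phi a (nabla G phi b V) p)
                      (fun c => nabla G phi c V p)).
Qed.

End AtPoint.

Section Constant.
Variables (k : R) (D : set R).
Hypothesis openD : open D.
Hypothesis HD : forall s, D s -> curved_at k s.
Implicit Types V W : 'rV[R]_2 -> 'rV[R]_3.

Let Fn0 p : D (p 0 0) -> bcv_factor m (gamma (p 0 0) 0 0) (gamma (p 0 0) 0 1) != 0.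
Proof. by move=> Dp; apply: lt0r_neq0; have [] := HD Dp. Qed.

Definition normal_on (b : R) V := forall p, D (p 0 0) -> V p = frame p 0 b 0.

(** k - (l/2) theta, the rotation rate of T towards N along d_s. It stays an expression because
    theta varies with s and a second covariant derivative follows. *)
Definition omega_expr : dpoly R := (k%:C + (- (l / 2))%:C * theta_expr l)%DP.

Lemma nabla_on (d : 'I_2) V W p : (forall q : 'rV[R]_2, D (q 0 0) -> V q = W q) -> D (p 0 0) ->
  nabla G phi d V p = nabla G phi d W p.
Proof.
move=> VW Dp; apply: nabla_near_eq.
apply: filterS (@near_coord R 2 p 0 D (open_nbhs_nbhs (conj openD Dp))) => q; exact: VW.
Qed.

Lemma nabla0_normal b V p : normal_on b V -> D (p 0 0) -> nabla G phi 0 V p =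
  frame_field ((- b)%:C * omega_expr)%DP 0%:C%DP (l / 2 * b)%:C%DP p.
Proof.
move=> HV Dp; rewrite (nabla_on 0 (W := frame_field 0%:C%DP b%:C%DP 0%:C%DP)) //.
rewrite (nabla_frame0 _ (HD Dp)) /frame_field.
by congr frame; rewrite /theta /=; ring.
Qed.

Lemma nabla1_normal b V p : normal_on b V -> D (p 0 0) -> nabla G phi 1 V p =
  frame_field (l / 2 * b)%:C%DP 0%:C%DP 0%:C%DP p.
Proof.
move=> HV Dp; rewrite (nabla_on 1 (W := frame_field 0%:C%DP b%:C%DP 0%:C%DP)) //.
rewrite (nabla_frame1 _ (HD Dp)) /frame_field.
by congr frame; rewrite /theta /=; ring.
Qed.

(** T and xi are parallel on the flat surface. For constant k, nabla_T nabla_T N = - (k^2 + l^2/4) N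
    and nabla_xi nabla_xi N = - (l^2/4) N. *)
Lemma rough_laplacian_normal b V : normal_on b V ->
  normal_on ((k ^+ 2 + l ^+ 2 / 2) * b) (rough_laplacian G phi V).
Proof.
move=> HV p Dp; have Hp := HD Dp; have F0 := Fn0 Dp.
have W0 q := @nabla0_normal b V q HV.
have W1 q := @nabla1_normal b V q HV.
rewrite (rough_laplacianE Hp
  (etrans (nabla_on 0 W0 Dp) (nabla_frame0 _ Hp _ _ _))
  (etrans (nabla_on 0 W1 Dp) (nabla_frame0 _ Hp _ _ _))
  (etrans (nabla_on 1 W0 Dp) (nabla_frame1 _ Hp _ _ _))
  (etrans (nabla_on 1 W1 Dp) (nabla_frame1 _ Hp _ _ _)) (W1 p Dp)).
rewrite /frame_field !frameE /dtheta.
by congr frame; rewrite /theta /=; field.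
Qed.

Lemma lap_tension_normal j :
  normal_on (k * (k ^+ 2 + l ^+ 2 / 2) ^+ j) (lap_tension G phi j).
Proof.
elim: j => [|j IH]; first by move=> p Dp; rewrite expr0 mulr1; exact: tension_hopf (HD Dp).
by move=> p Dp; rewrite /lap_tension /= (rough_laplacian_normal IH)// (exprS _ j) mulrCA.
Qed.

(** For V = b N, nabla_T V = b (- k T + (l/2) xi) and nabla_xi V = b (l/2) T. Only R(T, N) T = - K N
    contributes, as R(xi, N) T and R(T, N) xi vanish. *)
Lemma curv_nabla_l_normal b b' V W p : normal_on b V -> normal_on b' W -> D (p 0 0) ->
  curv_nabla_l G phi V W p = frame p 0 (b * b' * k * (4 * m - 3 / 4 * l ^+ 2)) 0.
Proof.
move=> HV HW Dp; have Hp := HD Dp; have F0 := Fn0 Dp.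
rewrite /curv_nabla_l (traceE _ Hp) HW// (nabla0_normal HV)// (nabla1_normal HV)//.
rewrite (dmap_curved Hp) (dmap1E m l) /frame_field !(curvature_frame Hp) /= !frameE.
by congr frame; rewrite /theta /=; field.
Qed.

(** The sign comes from the antisymmetry of R in its first two arguments. *)
Lemma curv_nabla_r_normal b b' V W p : normal_on b V -> normal_on b' W -> D (p 0 0) ->
  curv_nabla_r G phi V W p = frame p 0 (- (b * b' * k * (4 * m - 3 / 4 * l ^+ 2))) 0.
Proof.
move=> HV HW Dp; have Hp := HD Dp; have F0 := Fn0 Dp.
rewrite /curv_nabla_r (traceE _ Hp) HV// (nabla0_normal HW)// (nabla1_normal HW)//.
rewrite (dmap_curved Hp) (dmap1E m l) /frame_field !(curvature_frame Hp) /= !frameE.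
by congr frame; rewrite /theta /=; field.
Qed.

End Constant.
End HopfTension.

(** * The r-tension field *)

Section RTension.
Context {R : realType}.
Variables (m l : R) (gamma : R -> 'rV[R]_2) (k : R) (D : set R).
Local Notation G := (bcv_metric m l).
Local Notation phi := (hopf_cylinder gamma).
Local Notation frame := (frame m l gamma).
Local Notation lam := (k ^+ 2 + l ^+ 2 / 2).
Local Notation K := (4 * m - 3 / 4 * l ^+ 2).
Implicit Types p : 'rV[R]_2.
Hypothesis openD : open D.
Hypothesis HD : forall s, D s -> curved_at m gamma k s.

Lemma sum_frame p (b : R) i j :
  \sum_(i <= n < j) frame p 0 b 0 = frame p 0 ((j - i)%:R * b) 0.
Proof.
rewrite sumr_const_nat; apply/rowP => c; rewrite mulmxnE !mxE; ring.
Qed.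

(** For r = 2 the exponent [r - 3] is truncated to 0, which is harmless because the factor
    [(r - 2)%:R] vanishes. *)
Definition r_tension_coef (r : nat) : R :=
  k * lam ^+ (r - 1) - k * lam ^+ (r - 2) * (4 * m - l ^+ 2 / 2)
  - (r - 2)%:R * (k ^+ 3 * lam ^+ (r - 3) * K).

Lemma curv_nabla_diff i j p : D (p 0 0) ->
  curv_nabla_l G phi (lap_tension G phi i) (lap_tension G phi j) p
  - curv_nabla_r G phi (lap_tension G phi i) (lap_tension G phi j) p
  = frame p 0 (2 * (k ^+ 3 * lam ^+ (i + j) * K)) 0.
Proof.
move=> Dp; have Hi := lap_tension_normal l openD HD i.
have Hj := lap_tension_normal l openD HD j.
rewrite (curv_nabla_l_normal openD HD Hi Hj Dp) (curv_nabla_r_normal openD HD Hi Hj Dp).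
by rewrite !frameE exprD; congr frame; ring.
Qed.

Lemma tension_even_normal s p : D (p 0 0) -> (0 < s)%N ->
  tension_even G phi s p = frame p 0 (r_tension_coef (2 * s)) 0.
Proof.
move=> Dp s0; rewrite /tension_even (lap_tension_normal l openD HD)//.
rewrite (ricci_normal (HD Dp) (lap_tension_normal l openD HD _ Dp)).
(* The orders add up to (s + i - 2) + (s - i - 1) = 2 s - 3 for every i, so the s - 1 summands agree
   and give the factor 2 (s - 1) = r - 2. *)
rewrite (eq_big_nat _ _ (F2 := fun i => frame p 0 (2 * (k ^+ 3 * lam ^+ (2 * s - 3) * K)) 0)).
  rewrite sum_frame !frameE /r_tension_coef.
  have -> : (2 * s - 2 = 2 * (s - 1))%N by rewrite mulnBr.
  by rewrite natrM; congr frame; ring.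
move=> i /andP[i1 i2]; rewrite curv_nabla_diff//; congr (frame p 0 (2 * (_ * _ ^+ _ * _)) 0).
lia.
Qed.

Lemma tension_odd_normal s p : D (p 0 0) -> (0 < s)%N ->
  tension_odd G phi s p = frame p 0 (r_tension_coef (2 * s).+1) 0.
Proof.
move=> Dp s0; rewrite /tension_odd (lap_tension_normal l openD HD)//.
rewrite (ricci_normal (HD Dp) (lap_tension_normal l openD HD _ Dp)).
have H1 := lap_tension_normal l openD HD (s - 1).
rewrite (curv_nabla_l_normal openD HD H1 H1 Dp).
(* Again the orders have a constant sum, now 2 s - 2. The separate last curvature term has the same
   order and completes 2 (s - 1) to 2 (s - 1) + 1 = r - 2. *)
rewrite (eq_big_nat _ _ (F2 := fun i => frame p 0 (2 * (k ^+ 3 * lam ^+ (2 * s - 2) * K)) 0)).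
  rewrite sum_frame !frameE /r_tension_coef.
  have -> : ((2 * s).+1 - 2 = 2 * (s - 1) + 1)%N by lia.
  have -> : ((2 * s).+1 - 1 = 2 * s)%N by lia.
  have -> : ((2 * s).+1 - 3 = (s - 1) + (s - 1))%N by lia.
  have -> : (2 * s - 2 = (s - 1) + (s - 1))%N by lia.
  have -> : (2 * s - 1 = (s - 1) + (s - 1) + 1)%N by lia.
  by rewrite natrD natrM !exprD; congr frame; ring.
move=> i /andP[i1 i2]; rewrite curv_nabla_diff//; congr (frame p 0 (2 * (_ * _ ^+ _ * _)) 0).
lia.
Qed.

Lemma r_tension_normal r p : D (p 0 0) -> (2 <= r)%N ->
  r_tension G phi r p = frame p 0 (r_tension_coef r) 0.
Proof.
move=> Dp r2; rewrite /r_tension -[in RHS](odd_double_half r) -mul2n.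
have h0 : (0 < r./2)%N by rewrite half_gt0.
case: (odd r); first exact: tension_odd_normal.
by rewrite add0n tension_even_normal.
Qed.

Lemma r_tension_coef_eq0 r : (2 <= r)%N -> k != 0 ->
  r_tension_coef r = 0 <->
  lam ^+ 2 - lam * (4 * m - l ^+ 2 / 2) - (r - 2)%:R * k ^+ 2 * K = 0.
Proof.
move=> r2 k0.
have lam0 : lam != 0.
  rewrite lt0r_neq0// ltr_wpDr//; last by rewrite exprn_even_gt0.
  by rewrite divr_ge0// sqr_ge0.
(* The factor lam^2 avoids the negative exponent r - 3 that factoring out lam^(r-3) would need at r
   = 2. *)
have E : lam ^+ 2 * r_tension_coef r = k * lam ^+ (r - 1) *
  (lam ^+ 2 - lam * (4 * m - l ^+ 2 / 2) - (r - 2)%:R * k ^+ 2 * K).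
  case: r r2 => [|[|[|r]]]// _; rewrite /r_tension_coef.
    by rewrite subnn (_ : (2 - 1 = 1)%N)// (_ : (2 - 3 = 0)%N)//; ring.
  have -> : (r.+3 - 1 = r + 2)%N by lia.
  have -> : (r.+3 - 2 = r + 1)%N by lia.
  have -> : (r.+3 - 3 = r)%N by lia.
  by rewrite !exprD; move: (lam ^+ r) => L; ring.
split => [H|H].
  move: E; rewrite H mulr0 => /esym/eqP; rewrite !mulf_eq0 (negbTE k0) expf_eq0 (negbTE lam0).
  by rewrite andbF => /eqP.
move: E; rewrite H mulr0 => /eqP; rewrite mulf_eq0 expf_eq0 (negbTE lam0) andbF.
by move=> /eqP.
Qed.

End RTension.

(** * The quadratic equation for the squared curvature *)

Section Algebra.
Context {R : realType}.
Implicit Types m l x k b c : R.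

Definition harmonicity_eq m l (r : nat) (k : R) : Prop :=
  (k ^+ 2 + l ^+ 2 / 2) ^+ 2 - (k ^+ 2 + l ^+ 2 / 2) * (4 * m - l ^+ 2 / 2)
  - (r - 2)%:R * k ^+ 2 * (4 * m - 3 / 4 * l ^+ 2) = 0.

Definition admissible m l (r : nat) : Prop :=
  [\/ 0 < 4 * m - l ^+ 2 /\ (2 <= r)%N,
      [/\ 4 * m - l ^+ 2 = 0, l <> 0 & (5 <= r)%N] |
      [/\ 4 * m - l ^+ 2 < 0, 0 < 4 * m - 3 * l ^+ 2 / 4 &
          4 * (Num.sqrt 2 * Num.sqrt (l ^+ 4 - 4 * l ^+ 2 * m) + 4 * m)
            / (16 * m - 3 * l ^+ 2) <= r%:R]].

Lemma harmonicity_eqE m l r k : (2 <= r)%N ->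
  harmonicity_eq m l r k <->
  (k ^+ 2) ^+ 2 - (r%:R * (4 * m - 3 / 4 * l ^+ 2) - 4 * m) * k ^+ 2
    + l ^+ 2 / 2 * (l ^+ 2 - 4 * m) = 0.
Proof.
move=> r2; rewrite /harmonicity_eq natrB//.
by split=> H; rewrite -{}H; field.
Qed.

Lemma sqrt_discriminant m l :
  Num.sqrt 2 * Num.sqrt (l ^+ 4 - 4 * l ^+ 2 * m) =
  Num.sqrt (4 * (l ^+ 2 / 2 * (l ^+ 2 - 4 * m))).
Proof. by rewrite -sqrtrM//; congr Num.sqrt; field. Qed.

(** The denominator is 4 K > 0. Writing the quadratic in X = k^2 as X^2 - b X + c, the threshold
    becomes sqrt(4 c) <= b: for c >= 0, a nonnegative discriminant together with b >= 0. *)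
Lemma threshold_le m l r : 0 < 4 * m - 3 * l ^+ 2 / 4 ->
  (4 * (Num.sqrt 2 * Num.sqrt (l ^+ 4 - 4 * l ^+ 2 * m) + 4 * m)
            / (16 * m - 3 * l ^+ 2) <= r) =
  (Num.sqrt (4 * (l ^+ 2 / 2 * (l ^+ 2 - 4 * m))) <=
     r * (4 * m - 3 / 4 * l ^+ 2) - 4 * m).
Proof.
move=> K0; rewrite -sqrt_discriminant; set S := (X in 4 * (X + _)).
rewrite ler_pdivrMr; last lra.
have -> : r * (16 * m - 3 * l ^+ 2) = 4 * (r * (4 * m - 3 / 4 * l ^+ 2)) by field.
by rewrite ler_pM2l// lerBrDr.
Qed.

(** A positive root x of X^2 - b X + c, with c = (l^2/2) (l^2 - 4 m), satisfies b x = x^2 + c and (2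
    x - b)^2 = b^2 - 4 c. If 4 m < l^2, then c >= 0, so b > 0, and the second identity gives the
    threshold. *)
Lemma admissible_of_harmonicity m l r k : (2 <= r)%N -> k != 0 ->
  harmonicity_eq m l r k -> admissible m l r.
Proof.
move=> r2 k0 /(harmonicity_eqE _ _ _ r2).
have : 0 < k ^+ 2 by rewrite exprn_even_gt0.
move: (k ^+ 2) => x x0 E.
have l2 : 0 <= l ^+ 2 := sqr_ge0 l.
have [H|H|H] := ltrgt0P (4 * m - l ^+ 2).
- by constructor 1.
- constructor 3.
  have b0 : 0 < r%:R * (4 * m - 3 / 4 * l ^+ 2) - 4 * m.
    have : 0 < x * (r%:R * (4 * m - 3 / 4 * l ^+ 2) - 4 * m) by nra.
    by rewrite pmulr_rgt0.
  have r2' : 2 <= r%:R :> R by rewrite ler_nat.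
  (* If K <= 0, then r >= 2 and 4 m < l^2 give b <= 2 K - 4 m = 4 m - (3/2) l^2 < 0. *)
  have K0 : 0 < 4 * m - 3 * l ^+ 2 / 4 by nra.
  split=> //; rewrite threshold_le// -[leRHS](ger0_norm (ltW b0)) -sqrtr_sqr; apply: ler_wsqrtr.
  have := sqr_ge0 (2 * x - (r%:R * (4 * m - 3 / 4 * l ^+ 2) - 4 * m)); nra.
- constructor 2.
  (* With l = 0 also m = 0, and the equation reduces to x^2 = 0. *)
  have l0 : l <> 0.
    move=> l0; move: E H; rewrite l0 expr0n /= subr0 => E /eqP.
    rewrite mulf_eq0 pnatr_eq0 /= => /eqP m0; move: E; rewrite m0; nra.
  have lp : 0 < l ^+ 2 by rewrite exprn_even_gt0//; apply/eqP.
  split=> //; rewrite -(@ltr_nat R) -subr_gt0.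
  (* Here c = 0 and K = l^2/4, so the positive root is b = (l^2/4) (r - 4). *)
  suff : 0 < l ^+ 2 / 4 * (r%:R - 4) by rewrite pmulr_rgt0//; lra.
  have := mulr_gt0 x0 x0; nra.
Qed.

(** The larger root (b + s)/2 is positive: if c < 0 because s > |b|, if b > 0 because s >= 0. *)
Lemma root_pos b c : 0 <= b ^+ 2 - 4 * c -> c < 0 \/ 0 < b ->
  exists2 k, 0 < k & (k ^+ 2) ^+ 2 - b * k ^+ 2 + c = 0.
Proof.
move=> D0 H; pose s := Num.sqrt (b ^+ 2 - 4 * c); pose x := (b + s) / 2.
have s0 : 0 <= s := sqrtr_ge0 _.
have s2 : s ^+ 2 = b ^+ 2 - 4 * c by rewrite sqr_sqrtr.
have x0 : 0 < x by rewrite /x; case: H => H; nra.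
exists (Num.sqrt x); first by rewrite sqrtr_gt0.
by rewrite sqr_sqrtr ?ltW// /x; nra.
Qed.

Lemma harmonicity_of_admissible m l r : (2 <= r)%N -> admissible m l r ->
  0 < m /\ exists2 k, 0 < k & harmonicity_eq m l r k.
Proof.
move=> r2 H.
have l2 : 0 <= l ^+ 2 := sqr_ge0 l.
have r2' : 2 <= r%:R :> R by rewrite ler_nat.
suff [m0 [D0 H0]] : 0 < m /\
  let b := r%:R * (4 * m - 3 / 4 * l ^+ 2) - 4 * m in
  let c := l ^+ 2 / 2 * (l ^+ 2 - 4 * m) in
  0 <= b ^+ 2 - 4 * c /\ (c < 0 \/ 0 < b).
  split=> //; have [k k0 E] := root_pos D0 H0.
  by exists k => //; apply/harmonicity_eqE.
case: H => [[H _]|[H l0 r5]|[H K0]].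
- split; first lra.
  move=> b c; have c0 : c <= 0 by rewrite /c; nra.
  split; first by rewrite addr_ge0 ?sqr_ge0//; lra.
  (* If l = 0, then c = 0 and b = 4 m (r - 1) > 0; otherwise c < 0. *)
  have [l00|l00] := eqVneq (l ^+ 2) 0.
    right; rewrite /b l00; nra.
  by left; have : 0 < l ^+ 2 by [rewrite lt0r l00]; rewrite /c => ?; nra.
- have lp : 0 < l ^+ 2 by rewrite exprn_even_gt0//; apply/eqP.
  have r5' : 5 <= r%:R :> R by rewrite ler_nat.
  split; first lra.
  move=> b c; have -> : c = 0 by rewrite /c (_ : l ^+ 2 - 4 * m = 0) ?mulr0//; lra.
  split; first by rewrite mulr0 subr0 sqr_ge0.
  by right; rewrite /b; nra.
- rewrite threshold_le// => Hb.
  have lp : 0 < l ^+ 2 by lra.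
  split; first lra.
  move=> b c; have c0 : 0 < c by rewrite /c; nra.
  have S2 : Num.sqrt (4 * c) ^+ 2 = 4 * c by rewrite sqr_sqrtr//; lra.
  have S0 : 0 < Num.sqrt (4 * c) by rewrite sqrtr_gt0; lra.
  rewrite -/c -/b in Hb; split; last by right; lra.
  by rewrite -S2; nra.
Qed.

End Algebra.

(** * Arclength curves on an interval *)

Section ArclengthCurve.
Context {R : realType}.
Variables (m l : R).
Local Notation G := (bcv_metric m l).

(* At an end point of [I] the derivative is computed from one side only. *)
Lemma derive_eq0_on_interval (I : set R) (f : R -> R) s :
  nondegenerate_interval I -> I s -> (forall t, I t -> f t = 0) ->
  derivable f s 1 -> 'D_1 f s = 0.
Proof.
move=> [intI [a [b [Ia Ib ab]]]] Is f0 df.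
have key (t : R) : I t -> s <> t ->
    forall h : R, `|h| < `|t - s| -> 0 <= h * (t - s) -> f (h + s) = 0.
  move=> It st h h1 h2; apply: f0.
  have [st'|st'] := ltP s t.
    have ts : 0 < t - s by rewrite subr_gt0.
    move: h1 h2; rewrite (gtr0_norm ts) ltr_norml pmulr_lge0// => /andP[_ h1] h2.
    by apply: (intI _ _ Is It); apply/andP; split; lra.
  have ts : t - s < 0 by rewrite subr_lt0 lt_neqAle st' andbT; apply/eqP => e; apply: st.
  move: h1 h2; rewrite (ltr0_norm ts) ltr_norml nmulr_lge0// => /andP[h1 _] h2.
  by apply: (intI _ _ It Is); apply/andP; split; lra.
(* The point [s] cannot be both ends of [I]: the limit is taken from the right if s < b and from the
   left otherwise, and on that side the difference quotients are zero. *)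
rewrite /derive; have [sb|bs] := ltP s b.
  have bs : 0 < b - s by rewrite subr_gt0.
  rewrite cvg_at_rightE//; apply: cvg_lim => //; apply: cvg_near_cst.
  near=> h; rewrite (f0 s)// subr0 /= [h *: 1]mulr1 (key b) ?scaler0//.
  - by apply/eqP; rewrite lt_eqF.
  - rewrite (gtr0_norm bs) gtr0_norm; last by near: h; exact: nbhs_right_gt.
    by near: h; exact: nbhs_right_lt.
  - by apply: mulr_ge0; [near: h; exact: nbhs_right_ge | exact: ltW].
have as' : a < s by exact: lt_le_trans bs.
have sa : a - s < 0 by rewrite subr_lt0.
rewrite cvg_at_leftE//; apply: cvg_lim => //; apply: cvg_near_cst.
near=> h; rewrite (f0 s)// subr0 /= [h *: 1]mulr1 (key a) ?scaler0//.
- by apply/eqP; rewrite gt_eqF.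
- rewrite (ltr0_norm sa) ltr0_norm; last by near: h; exact: nbhs_left_lt.
  by rewrite ltrN2; near: h; exact: nbhs_left_gt.
- by apply: mulr_le0; [near: h; exact: nbhs_left_le | exact: ltW].
Unshelve. all: by end_near.
Qed.

Lemma inner_base_metric (q v : 'rV[R]_2) : inner (base_metric m q) v v =
  bcv_factor m (q 0 0) (q 0 1) ^- 2 * (v 0 0 ^+ 2 + v 0 1 ^+ 2).
Proof.
by rewrite /inner /base_metric mul_mx_scalar -scalemxAl mxE mxE big_ord2 !mxE -!expr2.
Qed.

Variables (I : set R) (gamma : R -> 'rV[R]_2).
Local Notation phi := (hopf_cylinder gamma).
Local Notation frame := (frame m l gamma).
Hypothesis ndI : nondegenerate_interval I.
Hypothesis arcI : arclength_curve_on m I gamma.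

Definition jet_env (s : R) : seq R :=
  curve_env m gamma s ++ [:: derive1n 2 gamma s 0 0; derive1n 2 gamma s 0 1].

(** Signed curvature for the conformal metric h: the determinant of velocity and acceleration, plus
    the correction from the conformal factor. *)
Definition geodesic_curvature_expr : dpoly R :=
  (DVar 2 * DVar 2 * (DVar 3 * DVar 6 + (-1)%:C * (DVar 4 * DVar 5))
   + (- (2 * m))%:C * DVar 2 * (DVar 0 * DVar 4 + (-1)%:C * (DVar 1 * DVar 3)))%DP.

Definition geodesic_curvature s := deval (jet_env s) geodesic_curvature_expr.

Lemma smooth_derive s n : I s ->
  is_derive s 1 (derive1n n gamma) (derive1n n.+1 gamma s).
Proof.
move=> Is; rewrite derive1nS derive1E; apply: derivableP.
by have [sm _] := arcI; exact: (nbhs_singleton (sm s Is)).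
Qed.

(** Differentiating the unit speed relation along [I], one-sidedly at an end point, fixes the
    tangential part of the acceleration; its normal part is what the geodesic curvature measures. *)
Lemma arclength_curved s : I s -> curved_at m gamma (geodesic_curvature s) s.
Proof.
move=> Is; have [sm arc] := arcI.
have speed t : I t -> 0 < bcv_factor m (gamma t 0 0) (gamma t 0 1) /\
    derive1 gamma t 0 0 ^+ 2 + derive1 gamma t 0 1 ^+ 2 =
      bcv_factor m (gamma t 0 0) (gamma t 0 1) ^+ 2.
  move=> It; have [F0 E] := arc t It; split => //.
  move: E; rewrite inner_base_metric.
  have F20 : bcv_factor m (gamma t 0 0) (gamma t 0 1) ^+ 2 != 0.
    by rewrite expf_eq0 /= lt0r_neq0.
  by move=> /(canRL (mulKf (invr_neq0 F20))) ; rewrite invrK mulr1.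
have [F0 Hs] := speed s Is.
have D0 := smooth_derive 0 Is; have D1 := smooth_derive 1 Is.
rewrite derive1n0 derive1n1 in D0; rewrite derive1n1 in D1.
split => //; first by apply: filterS (sm s Is) => t /(_ 0).
rewrite /geodesic_curvature /jet_env.
move: (derive1n 2 gamma s) D1 => g2 D1.
pose E t := [:: gamma t 0 0; gamma t 0 1; derive1 gamma t 0 0; derive1 gamma t 0 1].
pose dE := [seq (DCst x) | x <- [:: derive1 gamma s 0 0; derive1 gamma s 0 1;
   g2 0 0; g2 0 1]].
(* The unit speed relation a^2 + b^2 - F^2 = 0 in the entries of [E]. It is known on [I] only, not
   around [s] if [s] is an end point. *)
pose e := (DVar 2 * DVar 2 + DVar 3 * DVar 3
   + (-1)%:C * (factor_expr m * factor_expr m))%DP.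
have HE i : is_derive s 1 (fun t => (E t)`_i) (deval (E s) (nth (DCst 0) dE i)).
  case: i => [|[|[|[|i]]]].
  - exact: (is_derive_component D0 0).
  - exact: (is_derive_component D0 1).
  - exact: (is_derive_component D1 0).
  - exact: (is_derive_component D1 1).
  - by rewrite /= nth_nil; case: i => [|i]; exact: is_derive_cst.
have [De Ve] := is_derive_deval HE e.
have := derive_eq0_on_interval ndI Is _ De; rewrite Ve => H.
have {H}rel : derive1 gamma s 0 0 * g2 0 0
     + derive1 gamma s 0 1 * g2 0 1 =
   2 * m * bcv_factor m (gamma s 0 0) (gamma s 0 1) *
   (gamma s 0 0 * derive1 gamma s 0 0 + gamma s 0 1 * derive1 gamma s 0 1).
  have : deval (E s) (dderiv dE e) = 0.
    apply: H => t It; have [_ Ht] := speed t It.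
    rewrite /e /= -!expr2 Ht /bcv_factor; ring.
  by rewrite /bcv_factor /= => H'; lra.
apply: (is_derive_eq D1); apply/rowP => i; rewrite mxE.
move: F0 Hs rel.
elim/ord2_ind: i => /=.
all: set x := gamma s 0 0; set y := gamma s 0 1; set F := bcv_factor _ _ _;
  set a := derive1 gamma s 0 0; set b := derive1 gamma s 0 1;
  move=> F0 Hs rel; have Fn0 := lt0r_neq0 F0; apply: (mulfI (expf_neq0 2 Fn0));
  rewrite -[in LHS]Hs.
(* Decomposition in the orthogonal basis v = (a, b), Jv = (- b, a): |v|^2 g2 = (v . g2) v + det(v,
   g2) Jv, with v . g2 given by [rel]. *)
- transitivity (a * (2 * m * F * (x * a + y * b)) - b * (a * g2 0 1 - b * g2 0 0)).
    by rewrite -rel; ring.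
  by field.
- transitivity (b * (2 * m * F * (x * a + y * b)) + a * (a * g2 0 1 - b * g2 0 0)).
    by rewrite -rel; ring.
  by field.
Qed.

(** The coefficients [a] and [b] are the inner products in h of the projection of [v] with those of
    T and N; the last one absorbs what remains of the third component. *)
Lemma frame_surj (p : 'rV[R]_2) (v : 'rV[R]_3) : I (p 0 0) ->
  exists a b c, v = frame p a b c.
Proof.
move=> Ip; have Hp := arclength_curved Ip.
pose A := derive1 gamma (p 0 0) 0 0; pose B := derive1 gamma (p 0 0) 0 1.
pose u := (bcv_factor m (gamma (p 0 0) 0 0) (gamma (p 0 0) 0 1))^-1.
pose a := u ^+ 2 * (A * v 0 0 + B * v 0 1); pose b := u ^+ 2 * (A * v 0 1 - B * v 0 0).
pose w := frame p a b 0.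
exists a, b, (v 0 ord_max - w 0 ord_max).
have S : u ^+ 2 * B ^+ 2 = 1 - u ^+ 2 * A ^+ 2.
  by have := speed1 Hp; rewrite /= -/A -/B -/u => <-; ring.
apply/rowP; elim/ord3_ind; rewrite !mxE /= -?/A -?/B -?/u.
- by rewrite /a /b; ring: S.
- by rewrite /a /b; ring: S.
- ring.
Qed.

(** A unit normal is N or - N, so the mean curvature is k/2 or - k/2; squaring removes the choice of
    sign. *)
Lemma CMC_curvature : CMC_on G phi (hopf_domain I) ->
  exists H : R, forall s, I s -> geodesic_curvature s ^+ 2 = H.
Proof.
case=> eta [[_ Heta] [H HH]]; exists (4 * H ^+ 2) => s Is.
pose p : 'rV[R]_2 := \row_i [:: s; 0]`_i.
have ps : p 0 0 = s by rewrite mxE.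
have Ip : I (p 0 0) by rewrite ps.
have Hp := arclength_curved Ip.
have [n1 n2] := Heta p Ip; have := HH p Ip.
have := n2 0; have := n2 1; move: n1; rewrite /mean_curvature (tension_hopf _ Hp).
rewrite (dmap_curved l Hp) (dmap1E m l) /frame_field.
have [a [b [c ->]]] := frame_surj (eta p) Ip.
rewrite !(inner_frame _ Hp) ps /= => E1 E2 E3 E4.
have c0 : c = 0 by move: E2; rewrite !mulr0 !add0r mulr1.
have a0 : a = 0 by move: E3; rewrite c0 mulr1 mulr0 mul0r !addr0.
have b1 : b ^+ 2 = 1 by rewrite -E1 a0 c0; ring.
move: (geodesic_curvature s) E4 => k <-; rewrite a0 c0.
by rewrite -[LHS]mulr1 -{1}b1; field.
Qed.

End ArclengthCurve.

(** * Necessity: from a harmonic cylinder to the condition on m, l and r *)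

Section Forward.
Context {R : realType}.
Variables (m l : R) (r : nat) (I : set R) (gamma : R -> 'rV[R]_2).
Local Notation G := (bcv_metric m l).
Local Notation phi := (hopf_cylinder gamma).
Local Notation geodesic_curvature := (geodesic_curvature m gamma).
Hypothesis r2 : (2 <= r)%N.
Hypothesis ndI : nondegenerate_interval I.
Hypothesis arcI : arclength_curve_on m I gamma.

Lemma continuous_geodesic_curvature s : I s -> {for s, continuous geodesic_curvature}.
Proof.
move=> Is; have [F0 _ _ _] := arclength_curved ndI arcI Is.
have C n j := is_derive_continuous (is_derive_component (smooth_derive arcI n Is) j).
apply: continuous_deval; case=> [|[|[|[|[|[|[|i]]]]]]].
- exact: (C 0 0).
- exact: (C 0 1).
- exact: (continuous_bcv_factorV (C 0 0) (C 0 1) F0).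
- exact: (C 1 0).
- exact: (C 1 1).
- exact: (C 2 0).
- exact: (C 2 1).
- by rewrite /= nth_nil; exact: cvg_cst.
Qed.

Lemma admissible_of_hopf_cylinder :
  CMC_on G phi (hopf_domain I) ->
  proper_r_harmonic_on G phi (hopf_domain I) r -> admissible m l r.
Proof.
move=> /(CMC_curvature ndI arcI)[H HH] [harm nmin].
have H0 : H != 0.
  apply/eqP => H0; apply: nmin => p Ip.
  have Hp := arclength_curved ndI arcI Ip.
  rewrite (tension_hopf l Hp).
  have := HH _ Ip; rewrite H0 => /eqP; rewrite expf_eq0 /= => /eqP ->.
  by apply/rowP => i; rewrite !mxE; ring.
have [intI [a [b [Ia Ib ab]]]] := ndI.
pose s0 := (a + b) / 2.
have s0ab : s0 \in `]a, b[ by rewrite in_itv /=; apply/andP; split; rewrite /s0; lra.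
have nearI : \forall t \near s0, I t.
  apply: filterS (near_in_itvoo s0ab) => t; rewrite in_itv /= => /andP[t1 t2].
  by apply: (intI _ _ Ia Ib); rewrite !ltW.
have Is0 := nbhs_singleton nearI.
have k2 := HH _ Is0.
have k0 : geodesic_curvature s0 != 0.
  by apply: contraNneq H0 => k0; rewrite -k2 k0 expr0n.
(* Since k^2 is constant, k(t) is k(s0) or - k(s0). The latter lies at distance 2 |k(s0)| from
   k(s0), which continuity excludes near s0. *)
have near_k : \forall t \near s0,
    `|geodesic_curvature s0 - geodesic_curvature t| < `|geodesic_curvature s0|.
  have : geodesic_curvature t @[t --> s0] --> geodesic_curvature s0.
    exact: continuous_geodesic_curvature.
  by move/cvgrPdist_lt; apply; rewrite normr_gt0.
move: (geodesic_curvature s0) k0 k2 near_k => k k0 k2 near_k.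
have nearD : \forall t \near s0, I t /\ geodesic_curvature t = k.
  near=> t; have It : I t by near: t.
  split; first exact: It.
  have : geodesic_curvature t ^+ 2 == k ^+ 2 by rewrite k2 (HH t It).
  rewrite eqf_sqr => /orP[/eqP tk|/eqP tk]; first exact: tk.
  exfalso.
  have : `|k - geodesic_curvature t| < `|k| by near: t.
  rewrite tk opprK -mulr2n normrMn -subr_lt0 mulr2n addrK.
  by rewrite ltNge normr_ge0.
(* The iterated Laplacians need constant curvature on an open set of parameters. *)
pose D := (interior [set t | I t /\ geodesic_curvature t = k]).
have HD t : D t -> curved_at m gamma k t.
  by move=> /interior_subset[It <-]; exact: (arclength_curved ndI arcI It).
pose p : 'rV[R]_2 := \row_i [:: s0; 0]`_i.
have Dp : D (p 0 0) by rewrite mxE.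
have Ip : hopf_domain I p by have /interior_subset[] := Dp.
have := harm p Ip; rewrite (r_tension_normal l (@open_interior _ _) HD)//.
(* Pairing with the unit field N extracts the coefficient. *)
move=> /(congr1 (fun v => inner (G (phi p)) v (frame m l gamma p 0 1 0))).
rewrite (inner_frame _ (HD _ Dp)) /inner !mul0mx mxE => E.
apply: (admissible_of_harmonicity r2 k0); apply/(r_tension_coef_eq0 m l r2 k0).
by rewrite -E; ring.
Unshelve. all: by end_near.
Qed.

End Forward.

(** * Circles around the origin *)

Section Circle.
Context {R : realType}.
Variables (m l k rho : R).
Hypothesis (m0 : 0 < m) (rho0 : 0 < rho) (Hrho : m * rho ^+ 2 + k * rho = 1).
Local Notation G := (bcv_metric m l).

(** The family is closed under differentiation, up to a change of [u] and [v], so smoothness follows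
    by induction on the order. *)
Definition trig_curve (w : R) (u v : 'rV[R]_2) (s : R) : 'rV[R]_2 :=
  \row_i (u 0 i * cos (w * s) + v 0 i * sin (w * s)).

Lemma is_derive_trig_curve w u v (s : R) :
  is_derive s 1 (trig_curve w u v) (trig_curve w (w *: v) (- w *: u) s).
Proof.
have Dw : is_derive s 1 (fun t => w * t) w.
  have H := is_deriveZ w (is_derive_id s (1 : R)).
  by apply: (is_derive_eq H); rewrite /GRing.scale /= mulr1.
have Dc := is_derive1_comp (is_derive_cos (w * s)) Dw.
have Ds := is_derive1_comp (is_derive_sin (w * s)) Dw.
apply: is_derive_row => i.
pose E (t : R) := [:: cos (w * t); sin (w * t)].
pose dE := [:: (- sin (w * s) * w)%:C; (cos (w * s) * w)%:C]%DP.
have HE j : is_derive s 1 (fun t => (E t)`_j) (deval (E s) (nth (DCst 0) dE j)).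
  case: j => [|[|j]]; [exact: Dc|exact: Ds|].
  by rewrite /= nth_nil; case: j => [|j]; exact: is_derive_cst.
have H := is_derive_deval HE ((u 0 i)%:C * DVar 0 + (v 0 i)%:C * DVar 1)%DP.
apply: (is_derive_eq (near_eq_is_derive _ H)).
  by apply: filterE => t; rewrite mxE.
by rewrite !mxE /=; ring.
Qed.

Lemma derive1_trig_curve w u v :
  derive1 (trig_curve w u v) = trig_curve w (w *: v) (- w *: u).
Proof.
by apply/funext => s; rewrite derive1E; have [_ ->] := is_derive_trig_curve w u v s.
Qed.

Lemma derivable_trig_curve n w u v (s : R) : derivable (derive1n n (trig_curve w u v)) s 1.
Proof.
elim: n u v => [|n IH] u v; first by have [] := is_derive_trig_curve w u v s.
by rewrite derive1Sn derive1_trig_curve.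
Qed.

(** The angular velocity is F / rho, since unit speed in h means Euclidean speed F = 1 + m rho^2. *)
Definition circle : R -> 'rV[R]_2 :=
  trig_curve ((1 + m * rho ^+ 2) / rho) (rho *: coord_vec 0) (rho *: coord_vec 1).

Local Notation w := ((1 + m * rho ^+ 2) / rho).

Lemma circleE s : (circle s 0 0 = rho * cos (w * s)) * (circle s 0 1 = rho * sin (w * s)).
Proof. by rewrite !mxE /= !(mulr0, mul0r, mulr1, addr0, add0r). Qed.

Lemma derive1_circleE s : (derive1 circle s 0 0 = - (w * rho * sin (w * s))) *
  (derive1 circle s 0 1 = w * rho * cos (w * s)).
Proof.
rewrite /circle derive1_trig_curve !mxE /=.
by rewrite !(mulr0, mul0r, mulr1, addr0, add0r) !mulNr.
Qed.

Let F0 : 0 < 1 + m * rho ^+ 2.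
Proof. by rewrite ltr_wpDr// mulr_ge0 ?sqr_ge0// ltW. Qed.

Let rn0 : rho != 0. Proof. exact: lt0r_neq0. Qed.

Lemma circle_factor s : bcv_factor m (circle s 0 0) (circle s 0 1) = 1 + m * rho ^+ 2.
Proof.
rewrite /bcv_factor !circleE !exprMn -mulrDr.
by move: (w * s) => th; rewrite cos2Dsin2 mulr1.
Qed.

Lemma circle_speed s : derive1 circle s 0 0 ^+ 2 + derive1 circle s 0 1 ^+ 2 =
  (1 + m * rho ^+ 2) ^+ 2.
Proof.
rewrite !derive1_circleE sqrrN !exprMn -mulrDr.
by move: (w * s) => th; rewrite [X in _ * X]addrC cos2Dsin2 mulr1; field.
Qed.

(** A Euclidean circle of radius rho around the origin has curvature 1/rho - m rho in M^2(4m), and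
    [Hrho] says that this is k. *)
Lemma circle_curved s : curved_at m circle k s.
Proof.
have kE : k = (1 - m * rho ^+ 2) / rho by rewrite -Hrho; field.
split.
- by rewrite circle_factor.
- apply: filterE => t.
  by have [] := is_derive_trig_curve w (rho *: coord_vec 0) (rho *: coord_vec 1) t.
- by rewrite circle_speed circle_factor.
- have E : derive1 circle = trig_curve w (w *: (rho *: coord_vec 1)) (- w *: (rho *: coord_vec 0)).
    exact: derive1_trig_curve.
  rewrite {1}E; apply: (is_derive_eq (is_derive_trig_curve _ _ _ _)); apply/rowP => i.
  rewrite [RHS]mxE /curve_env circle_factor !circleE !derive1_circleE.
  have Fn0 := lt0r_neq0 F0.
  elim/ord2_ind: i; rewrite !mxE /=.
  all: have C := cos2Dsin2 (w * s); move: (cos (w * s)) (sin (w * s)) C => c d C.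
  all: have {}C : c ^+ 2 = 1 - d ^+ 2 by rewrite -C addrK.
  all: by rewrite kE; field: C; rewrite rn0.
Qed.

Let Icircle : arclength_curve_on m setT circle.
Proof.
split=> [s _|s _].
  by apply: filterE => t n; exact: derivable_trig_curve.
split; first by rewrite /base_domain /= circle_factor.
by rewrite inner_base_metric circle_speed circle_factor mulVf// expf_neq0// lt0r_neq0.
Qed.

Lemma continuous_normal : continuous (fun p => frame m l circle p 0 1 0).
Proof.
move=> p; apply: continuous_row => i.
have [_ Hd _ Ha] := circle_curved (p 0 0).
have Dg : is_derive (p 0 0) 1 circle (derive1 circle (p 0 0)).
  by rewrite derive1E; apply: derivableP; exact: nbhs_singleton Hd.
have C j := is_derive_continuous (is_derive_component Dg j).
have C' j := is_derive_continuous (is_derive_component Ha j).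
have CE : {for p 0 0, continuous (fun s => deval (curve_env m circle s) (normal_expr l i))}.
  apply: continuous_deval; case=> [|[|[|[|[|j]]]]].
  - exact: (C 0).
  - exact: (C 1).
  - by apply: (continuous_bcv_factorV (C 0) (C 1)); rewrite circle_factor.
  - exact: (C' 0).
  - exact: (C' 1).
  - by rewrite /= nth_nil; exact: cvg_cst.
rewrite (_ : (fun q => _) = (fun s => deval (curve_env m circle s) (normal_expr l i)) \o
   (fun q : 'rV[R]_2 => q 0 0)).
  apply: continuous_comp; [exact: continuous_coord | exact: CE].
by apply/funext => q; rewrite mxE /=; ring.
Qed.

Lemma circle_hopf_cylinder r : (2 <= r)%N -> k != 0 -> harmonicity_eq m l r k ->
  exists (I : set R) (gamma : R -> 'rV[R]_2),
      [/\ nondegenerate_interval I,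
          arclength_curve_on m I gamma,
          CMC_on (bcv_metric m l) (hopf_cylinder gamma) (hopf_domain I) &
          proper_r_harmonic_on (bcv_metric m l) (hopf_cylinder gamma)
            (hopf_domain I) r].
Proof.
move=> r2 k0 Hk; exists setT, circle; split.
- by split; [move=> x y _ _ z _|exists 0, 1; split].
- exact: Icircle.
- exists (fun p => frame m l circle p 0 1 0); split.
    split; first by apply: continuous_subspaceT; exact: continuous_normal.
    move=> p _; have Hp := circle_curved (p 0 0).
    split; first by rewrite (inner_frame _ Hp); ring.
    elim/ord2_ind; [rewrite (dmap_curved l Hp)|rewrite (dmap1E m l)];
      by rewrite (inner_frame _ Hp) /=; ring.
  exists (k / 2) => p _; have Hp := circle_curved (p 0 0).
  by rewrite /mean_curvature (tension_hopf l Hp) (inner_frame _ Hp); field.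
- split=> [p _|min0].
    rewrite (r_tension_normal l openT (fun s _ => circle_curved s))//.
    rewrite ((r_tension_coef_eq0 m l r2 k0).2 Hk).
    by apply/rowP => i; rewrite !mxE; ring.
  have Hp := circle_curved ((0 : 'rV[R]_2) 0 0).
  have := min0 0 I; rewrite (tension_hopf l Hp).
  move=> /(congr1 (fun v =>
    inner (bcv_metric m l (hopf_cylinder circle 0)) v (frame m l circle 0 0 1 0))).
  rewrite (inner_frame _ Hp) /inner !mul0mx mxE => E.
  by move/eqP: k0; apply; rewrite -E; ring.
Qed.

End Circle.

Theorem corollary6p3 (R : realType) (m l : R) (r : nat) (hr : (2 <= r)%N) :
  (exists (I : set R) (gamma : R -> 'rV[R]_2),
      [/\ nondegenerate_interval I,
          arclength_curve_on m I gamma,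
          CMC_on (bcv_metric m l) (hopf_cylinder gamma) (hopf_domain I) &
          proper_r_harmonic_on (bcv_metric m l) (hopf_cylinder gamma)
            (hopf_domain I) r])
  <->
  [\/ 0 < 4 * m - l ^+ 2 /\ (2 <= r)%N,
      [/\ 4 * m - l ^+ 2 = 0, l <> 0 & (5 <= r)%N] |
      [/\ 4 * m - l ^+ 2 < 0, 0 < 4 * m - 3 * l ^+ 2 / 4 &
          4 * (Num.sqrt 2 * Num.sqrt (l ^+ 4 - 4 * l ^+ 2 * m) + 4 * m)
            / (16 * m - 3 * l ^+ 2) <= r%:R]].
Proof.
split=> [[I [gamma [ndI arcI cmc harm]]]|adm].
  exact: (admissible_of_hopf_cylinder hr ndI arcI cmc harm).
have [m0 [k k0 Hk]] := harmonicity_of_admissible hr adm.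
(* [rho] is the positive root of m rho^2 + k rho = 1, the radius of the circle of curvature k. *)
pose S := Num.sqrt (k ^+ 2 + 4 * m); pose rho := (S - k) / (2 * m).
have S2 : S ^+ 2 = k ^+ 2 + 4 * m.
  by rewrite sqr_sqrtr// addr_ge0 ?sqr_ge0// mulr_ge0// ltW.
have S0 : 0 <= S := sqrtr_ge0 _.
have rho0 : 0 < rho by rewrite divr_gt0 ?mulr_gt0// subr_gt0; nra.
have Hrho : m * rho ^+ 2 + k * rho = 1.
  rewrite /rho; have -> : m * ((S - k) / (2 * m)) ^+ 2 + k * ((S - k) / (2 * m)) =
    (S ^+ 2 - k ^+ 2) / (4 * m) by field; exact: lt0r_neq0.
  by rewrite S2; field; exact: lt0r_neq0.
by apply: (circle_hopf_cylinder m0 rho0 Hrho hr _ Hk); exact: lt0r_neq0.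
Qed.
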